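(* $$\frac{y}{s-1}\sum_{n=0}^{\infty}\frac{1}{n+1}\sum_{k=0}^{n}\binom{n}{k}\frac{(-1)^k y^k}{(k+1)^{s-1}}=\frac{\log y}{s-1}\,Li_{s-1}(y)+Li_s(y).$$ With $y=1$ this becomes the formula discovered by Hasse in 1930: $$\frac{1}{s-1}\sum_{n=0}^{\infty}\frac{1}{n+1}\sum_{k=0}^{n}\binom{n}{k}\frac{(-1)^k}{(k+1)^{s-1}}=Li_s(1)=\varsigma(s).$$
   Context: $Li_s(y)=\sum_{n=1}^{\infty}\frac{y^n}{n^s}$ denotes the polylogarithm and $\varsigma(s)$ is the Riemann zeta function.
   Formalization: The sign of the log y/(s-1) Li_{s-1}(y) term is corrected to minus (the printed plus fails at s=2, y=1/2); the first formula is stated for s≠1, |1-y|<1 with both Li series convergent, and Hasse's formula for Re s>1, where Li_s(1) converges. *)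

(* Defs.v *)
(* Stdlib reals with Coquelicot's complex numbers. *)
From Stdlib Require Export Reals.
From Coquelicot Require Export Coquelicot.

Open Scope C_scope.

Definition Cexp (z : C) : C :=
  ((exp (Re z) * cos (Im z))%R, (exp (Re z) * sin (Im z))%R).

(* Principal argument, with values in ]-PI, PI]; the value at 0 is
   unspecified. *)
Definition Carg (z : C) : R :=
  if Rle_dec 0 (Im z) then acos (Re z / Cmod z) else (- acos (Re z / Cmod z))%R.

(* Principal branch. *)
Definition Clog (z : C) : C := (ln (Cmod z), Carg z).

(* x ^ w for a positive real base x and a complex exponent w. *)
Definition Rcpower (x : R) (w : C) : C := Cexp (w * ln x).

Definition ex_Cseries (a : nat -> C) : Prop :=
  @ex_series C_AbsRing C_NormedModule a.

(* Coquelicot's [Series] only sums real sequences.  This is the sum of the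
   complex series when [ex_Cseries a] holds, and is meaningless otherwise. *)
Definition CSeries (a : nat -> C) : C :=
  (Series (fun n => Re (a n)), Series (fun n => Im (a n))).

(* Series start at n = 0, so the index is shifted by one. *)
Definition polylog_term (s y : C) (n : nat) : C :=
  y ^ S n / Rcpower (INR (S n)) s.

Definition polylog (s y : C) : C := CSeries (polylog_term s y).

(* The Dirichlet series of the Riemann zeta function: only meaningful on the
   half-plane of convergence 1 < Re s. *)
Definition zeta (s : C) : C := CSeries (fun n => 1 / Rcpower (INR (S n)) s).

(* Main.v *)
From Stdlib Require Import Lra Lia.
Require Import Defs.

(** Put sigma = s - 1 and c(x) = (x + 1)^(- sigma), and let E be the shift
(E a)(x) = a(x + 1). The inner sum of Hasse's series is ((1 - y E)^n c)(0), so
the series is F(0), where F(x) = sum_n ((1 - y E)^n c)(x) / (n + 1). Since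
F(x) - y F(x + 1) = sum_(n >= 1) ((1 - y E)^n c)(x) / n and E = exp(d/dx), one
expects
   F(x) - y F(x + 1) = - log(y E) c (x) = - log y c(x) - c'(x).
Multiplying by y^x and summing over x = 0, 1, 2, ... then gives
   F(0) = sum_x y^x (- log y c(x) + sigma (x + 1)^(- s)),
which is the theorem up to the factor y / sigma, as soon as y^N F(N) tends
to 0. So two things have to be shown: the logarithmic series converges to
- log y c - c', and F(x) is O((x + 1)^(- Re sigma)).

Both are usually read off the Laplace transform
Gamma(sigma) c(x) = int_0^oo u^(sigma - 1) e^(- u) e^(- u x) du. Here the
integral is replaced by a comparison of derivatives. For Re sigma >= 2 every
derivative of c is bounded by the corresponding derivative of
g(x) = K (x + 1)^(- Re sigma), with one constant K for all orders
([Cmod_poch_le]). Splitting 1 - y E = (1 - E) + (1 - y) E, the bound passes to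
|(1 - y E)^n c| <= (1 - theta E)^n g with theta = 1 - |1 - y| > 0
([tower_dominates]), and everything reduces to the completely monotone g.

For the logarithmic series, let the step of the shift be a parameter v in
[0, 1]. At v = 0 it is the Taylor series of - log y, times c(x); its derivative in
v telescopes to - c'(x) up to a remainder (1 - y E_v)^M c'(x), which tends to 0
uniformly in v ([logsum_cderiv], [tower_log_error], [tower_log_limit]). For g
the remainder has a sign, which bounds sum_n ((1 - theta E)^n g)(x) / n
([tower_log_bound]) and hence F.

Small and negative Re sigma are reached by multiplying c by x + 1, which
replaces sigma by sigma - 1. This costs a factor n in the differences, so the
induction carries bounds on sums weighted by arbitrary powers of n
([hasse_summable], [hasse_shift], [npow_hasse]). The summation over x is
[hasse_sum]; the convergence of Li_(s - 1)(y) makes its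
boundary term vanish. At y = 1 the logarithm is 0 and the boundary term is
O(N^(1 - Re s)), so 1 < Re s suffices. *)

(** * Functions of a real variable with complex values *)

(** Taken componentwise, so that the real mean value theorem and the real
    derivative rules apply without a theory of vector-valued derivatives. *)
Definition cderiv (f : R -> C) (x : R) (l : C) : Prop :=
  is_derive (fun t => Re (f t)) x (Re l) /\ is_derive (fun t => Im (f t)) x (Im l).

Lemma cderiv_ext f g x l l' :
  (forall t, f t = g t) -> l = l' -> cderiv f x l -> cderiv g x l'.
Proof.
  intros E <- [H1 H2]; split.
  - apply (is_derive_ext (fun t => Re (f t))); [intros t; now rewrite E | exact H1].
  - apply (is_derive_ext (fun t => Im (f t))); [intros t; now rewrite E | exact H2].
Qed.

Lemma cderiv_plus f g x l m :
  cderiv f x l -> cderiv g x m -> cderiv (fun t => f t + g t) x (l + m).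
Proof.
  intros [H1 H2] [H3 H4]; split.
  - exact (is_derive_plus (V := R_NormedModule) _ _ _ _ _ H1 H3).
  - exact (is_derive_plus (V := R_NormedModule) _ _ _ _ _ H2 H4).
Qed.

Lemma cderiv_scal (c : C) f x l : cderiv f x l -> cderiv (fun t => c * f t) x (c * l).
Proof.
  intros [H1 H2]; split; simpl.
  - apply (is_derive_minus (V := R_NormedModule));
      now apply (is_derive_scal (fun t => _)).
  - apply (is_derive_plus (V := R_NormedModule));
      now apply (is_derive_scal (fun t => _)).
Qed.

Lemma cderiv_minus f g x l m :
  cderiv f x l -> cderiv g x m -> cderiv (fun t => f t - g t) x (l - m).
Proof.
  intros Hf Hg.
  apply (cderiv_ext (fun t => f t + (-1) * g t) _ x (l + (-1) * m)).
  - intros t; ring.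
  - ring.
  - apply cderiv_plus; [|apply cderiv_scal]; assumption.
Qed.

Lemma cderiv_line (c : C) x : cderiv (fun t : R => t * c) x c.
Proof. split; simpl; auto_derive; trivial; unfold Re, Im; ring. Qed.

Lemma cderiv_comp_affine f (x v k : R) l :
  cderiv f (x + k * v)%R l -> cderiv (fun t => f (x + k * t)%R) v (k * l).
Proof.
  assert (A : is_derive (fun t => x + k * t)%R v k) by (auto_derive; trivial; ring).
  intros [H1 H2]; split.
  - rewrite re_scal_l.
    apply (is_derive_comp (fun u => Re (f u)) _ _ _ _ H1 A).
  - rewrite im_scal_l.
    apply (is_derive_comp (fun u => Im (f u)) _ _ _ _ H2 A).
Qed.

Lemma is_derive_le (f g f' g' : R -> R) a b :
  (a <= b)%R ->
  (forall t, (a <= t <= b)%R -> is_derive f t (f' t)) ->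
  (forall t, (a <= t <= b)%R -> is_derive g t (g' t)) ->
  (forall t, (a <= t <= b)%R -> (f' t <= g' t)%R) ->
  (f b - f a <= g b - g a)%R.
Proof.
  intros Hab Hf Hg Hle.
  assert (Hd : forall t, (a <= t <= b)%R ->
             is_derive (fun t => g t - f t)%R t (g' t - f' t)%R).
  { intros t Ht. apply (is_derive_minus (V := R_NormedModule)); auto. }
  destruct (MVT_gen (fun t => g t - f t)%R a b (fun t => g' t - f' t)%R)
    as [c [Hc E]].
  - intros x; rewrite Rmin_left, Rmax_right by lra; intros; apply Hd; lra.
  - intros x; rewrite Rmin_left, Rmax_right by lra; intros Hx.
    apply continuity_pt_filterlim.
    apply (ex_derive_continuous (V := R_NormedModule) (fun t => g t - f t)%R).
    eexists; apply Hd; lra.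
  - rewrite Rmin_left, Rmax_right in Hc by lra.
    specialize (Hle c Hc). cbv beta in E. nra.
Qed.

(** The mean value inequality. Projecting f on the direction of f b - f a turns
    it into a comparison of two real functions. *)
Lemma cderiv_le f (f' : R -> C) (g g' : R -> R) a b :
  (a <= b)%R ->
  (forall t, (a <= t <= b)%R -> cderiv f t (f' t)) ->
  (forall t, (a <= t <= b)%R -> is_derive g t (g' t)) ->
  (forall t, (a <= t <= b)%R -> (Cmod (f' t) <= g' t)%R) ->
  (Cmod (f b - f a) <= g b - g a)%R.
Proof.
  intros Hab Hf Hg Hle.
  (* The inner product with w recovers |w|^2 from the increment of f. *)
  set (w := f b - f a).
  assert (Hw := Cmod_ge_0 w).
  assert (Hsq : (Cmod w * Cmod w = Re w * Re w + Im w * Im w)%R).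
  { unfold Cmod. rewrite sqrt_sqrt by nra. unfold Re, Im. ring. }
  assert (M := is_derive_le
    (fun t => Re (Cconj w * f t)) (fun t => Cmod w * g t)%R
    (fun t => Re (Cconj w * f' t)) (fun t => Cmod w * g' t)%R a b Hab).
  assert (M' : (Re (Cconj w * f b) - Re (Cconj w * f a) <= Cmod w * g b - Cmod w * g a)%R).
  { apply M.
    - intros t Ht. apply (cderiv_scal (Cconj w) f t (f' t) (Hf t Ht)).
    - intros t Ht. apply (is_derive_scal); auto.
    - intros t Ht. apply Rle_trans with (Cmod (Cconj w * f' t)).
      + eapply Rle_trans; [apply Rle_abs | apply re_le_Cmod].
      + rewrite Cmod_mult, Cmod_conj. apply Rmult_le_compat_l; auto. }
  assert (E : (Re (Cconj w * f b) - Re (Cconj w * f a) = Cmod w * Cmod w)%R).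
  { rewrite Hsq. unfold w; simpl. ring. }
  rewrite E in M'.
  assert (Hmono : (0 <= g b - g a)%R).
  { assert (X := is_derive_le (fun _ => 0%R) g (fun _ => 0%R) g' a b Hab).
    assert ((0 - 0 <= g b - g a)%R); [|lra].
    apply X; auto.
    - intros; apply (is_derive_const (V := R_NormedModule)).
    - intros t Ht; eapply Rle_trans; [apply Cmod_ge_0 | auto]. }
  destruct (Rle_lt_or_eq_dec 0 _ Hw) as [Hpos | Hz]; [|lra].
  apply Rmult_le_reg_l with (Cmod w); [assumption|lra].
Qed.

(** * Iterates of 1 - y E on sequences *)

(** The value at k of (1 - y E)^n a, where E is the shift (E a) k = a (k + 1).
    For y = 1 these are the finite differences of a, up to sign. *)
Fixpoint D (y : C) (n : nat) (a : nat -> C) (k : nat) : C :=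
  match n with
  | O => a k
  | S n => D y n a k - y * D y n a (S k)
  end.

Lemma D_ext y n : forall a b k, (forall j, a j = b j) -> D y n a k = D y n b k.
Proof. induction n; intros; simpl; auto. now rewrite (IHn a b k), (IHn a b (S k)). Qed.

Lemma D_shift y n : forall a k, D y n a (S k) = D y n (fun j => a (S j)) k.
Proof. induction n; intros; simpl; auto. now rewrite !IHn. Qed.

Lemma D_shift_n y n a x : D y n a x = D y n (fun j => a (x + j)%nat) 0.
Proof.
  revert a; induction x; intros a.
  - now apply D_ext.
  - rewrite D_shift, IHx. apply D_ext. intros; f_equal; lia.
Qed.

Lemma D_opp y n : forall a k, D y n (fun j => - a j) k = - D y n a k.
Proof. induction n; intros; simpl; auto. rewrite !IHn; ring. Qed.

Lemma D_const y (c : C) n : forall k, D y n (fun _ => c) k = (1 - y) ^ n * c.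
Proof. induction n; intros; simpl; [ring|]. rewrite !IHn; ring. Qed.

(** The Leibniz rule of 1 - y E for the weight j + b, whose difference is
    constant. It is used with b = 0 to differentiate in the step of a sampled
    sequence, and with b = 1 to lower the exponent of a power. *)
Lemma D_weight y (b : C) a n : forall k,
  D y (S n) (fun j => (INR j + b) * a j) k
  = (INR k + b) * D y (S n) a k - INR (S n) * y * D y n a (S k).
Proof.
  induction n; intros k.
  - cbn [D]. rewrite !S_INR, !RtoC_plus. change (INR 0) with 0%R. ring.
  - change (D y (S (S n)) (fun j => (INR j + b) * a j) k) with
      (D y (S n) (fun j => (INR j + b) * a j) k
       - y * D y (S n) (fun j => (INR j + b) * a j) (S k)).
    rewrite !IHn. cbn [D]. rewrite !S_INR, !RtoC_plus. ring.
Qed.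

Lemma D_cderiv y (a : R -> nat -> C) (a' : nat -> C) t0 n :
  (forall k, cderiv (fun t => a t k) t0 (a' k)) ->
  forall k, cderiv (fun t => D y n (a t) k) t0 (D y n a' k).
Proof.
  intros H; induction n; intros k; simpl; auto.
  apply cderiv_minus; [|apply cderiv_scal]; auto.
Qed.

(** A real part rather than a second recursion, so that the identities and
    derivatives of [D] can be used for real sequences. *)
Definition DR (t : R) (n : nat) (g : nat -> R) (k : nat) : R :=
  Re (D t n (fun j => RtoC (g j)) k).

Lemma DR_S t n g k : DR t (S n) g k = (DR t n g k - t * DR t n g (S k))%R.
Proof. unfold DR. rewrite <- re_scal_l. reflexivity. Qed.

Lemma DR_ext t n g h k : (forall j, g j = h j) -> DR t n g k = DR t n h k.
Proof. intros H; unfold DR. f_equal. apply D_ext. intros; now rewrite H. Qed.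

Lemma DR_shift t n g k : DR t n g (S k) = DR t n (fun j => g (S j)) k.
Proof. unfold DR. now rewrite D_shift. Qed.

(** * Derivative towers and domination *)

(** Here f m is (-1)^m times the m-th derivative of f 0, and likewise for g:
    the real function g 0 is completely monotone and majorizes f 0 together
    with all its derivatives. *)
Definition tower (f : nat -> R -> C) (g : nat -> R -> R) : Prop :=
  forall m x, (0 <= x)%R ->
    cderiv (f m) x (- f (S m) x) /\
    is_derive (g m) x (- g (S m) x)%R /\
    (Cmod (f m x) <= g m x)%R.

(** The step v is a variable because the logarithmic series is differentiated
    with respect to it. *)
Definition sample {T} (f : R -> T) (x v : R) : nat -> T := fun k => f (x + INR k * v)%R.

Arguments sample {T} f (x v)%_R_scope.

Lemma sample_S {T} (f : R -> T) x v k : sample f x v (S k) = sample f (x + v) v k.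
Proof. unfold sample. f_equal. rewrite S_INR. ring. Qed.

Lemma D_sample_S {y n} f x v : D y n (sample f x v) 1 = D y n (sample f (x + v) v) 0.
Proof. rewrite D_shift. apply D_ext. intros; apply sample_S. Qed.

Lemma DR_sample_S {t n} f x v : DR t n (sample f x v) 1 = DR t n (sample f (x + v) v) 0.
Proof. rewrite DR_shift. apply DR_ext. intros; apply sample_S. Qed.

Lemma tower_real f g : tower f g -> tower (fun m x => RtoC (g m x)) g.
Proof.
  intros T m x Hx. destruct (T m x Hx) as [_ [H2 H3]].
  assert (H4 := Cmod_ge_0 (f m x)).
  split; [split|split]; [exact H2 | | exact H2 |].
  - replace (Im (- RtoC (g (S m) x))) with 0%R by (simpl; ring).
    exact (is_derive_const (V := R_NormedModule) 0%R x).
  - rewrite Cmod_R, Rabs_pos_eq; lra.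
Qed.

Lemma tower_tail f g : tower f g -> tower (fun m => f (S m)) (fun m => g (S m)).
Proof. intros T m; apply T. Qed.

Lemma tower_D_cderiv y f g n m x v : tower f g -> (0 <= x)%R -> (0 <= v)%R ->
  cderiv (fun t => D y n (sample (f m) t v) 0) x (- D y n (sample (f (S m)) x v) 0).
Proof.
  intros T Hx Hv. rewrite <- D_opp. apply D_cderiv. intros k.
  assert (Hp : (0 <= x + INR k * v)%R) by (assert (H := pos_INR k); nra).
  destruct (T m _ Hp) as [[H1 H2] _]; split; unfold sample.
  - rewrite <- (Rmult_1_l (Re _)).
    apply (is_derive_comp (fun t => Re (f m t)) (fun t => t + INR k * v)%R _ _ _ H1).
    auto_derive; trivial.
  - rewrite <- (Rmult_1_l (Im _)).
    apply (is_derive_comp (fun t => Im (f m t)) (fun t => t + INR k * v)%R _ _ _ H2).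
    auto_derive; trivial.
Qed.

(** Write 1 - y E = (1 - E) + (1 - y) E. The mean value inequality bounds the
    part in 1 - E by the same difference of the majorant, one level of the
    tower higher, and the part in E costs a factor |1 - y|. For
    theta = 1 - |1 - y| the same splitting of 1 - theta E is an identity between
    nonnegative terms, so the two bounds add up without loss. *)
Lemma tower_dominates y f g : tower f g -> forall n m x v, (0 <= x)%R -> (0 <= v)%R ->
  (Cmod (D y n (sample (f m) x v) 0)
   <= DR (1 - Cmod (1 - y)) n (sample (g m) x v) 0)%R.
Proof.
  intros T; induction n as [|n IH]; intros m x v Hx Hv.
  - unfold DR; simpl. unfold sample. apply T. simpl; lra.
  - set (th := (1 - Cmod (1 - y))%R) in *.
    rewrite DR_S, DR_sample_S. simpl D. rewrite D_sample_S.
    set (u := D y n (sample (f m) x v) 0).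
    set (u1 := D y n (sample (f m) (x + v) v) 0).
    replace (u - y * u1) with ((u - u1) + (1 - y) * u1) by ring.
    eapply Rle_trans; [apply Cmod_triangle|]. rewrite Cmod_mult.
    assert (H1 : (Cmod u1 <= DR th n (sample (g m) (x + v) v) 0)%R) by (apply IH; lra).
    assert (H2 : (Cmod (u - u1) <= DR th n (sample (g m) x v) 0
                                   - DR th n (sample (g m) (x + v) v) 0)%R).
    { rewrite <- Cmod_opp. replace (- (u - u1)) with (u1 - u) by ring.
      assert (X := cderiv_le (fun t => D y n (sample (f m) t v) 0)
        (fun t => - D y n (sample (f (S m)) t v) 0)
        (fun t => - DR th n (sample (g m) t v) 0)%R
        (fun t => DR th n (sample (g (S m)) t v) 0) x (x + v)).
      fold u u1 in X.
      match goal with |- (_ <= ?r)%R => match type of X with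
        _ -> _ -> _ -> _ -> (_ <= ?r')%R => replace r with r' by ring end end.
      apply X; [lra | | |].
      - intros t Ht. apply tower_D_cderiv with g; auto; lra.
      - intros t Ht.
        assert (Y := tower_D_cderiv th _ _ n m t v (tower_real f g T) ltac:(lra) Hv).
        rewrite <- (Ropp_involutive (DR th n (sample (g (S m)) t v) 0)).
        apply (is_derive_opp (V := R_NormedModule)). apply Y.
      - intros t Ht. rewrite Cmod_opp. apply IH; lra. }
    assert (H3 := Cmod_ge_0 (1 - y)).
    unfold th in *. nra.
Qed.

(** * Finite sums *)

Definition csum (u : nat -> C) (n : nat) : C := sum_n u n.

Lemma csum_0 u : csum u 0 = u O.
Proof. apply (sum_O u). Qed.

Lemma csum_S u n : csum u (S n) = csum u n + u (S n).
Proof. apply (sum_Sn u n). Qed.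

Lemma rsum_S (u : nat -> R) n : sum_n u (S n) = (sum_n u n + u (S n))%R.
Proof. apply (sum_Sn u n). Qed.

Lemma csum_ext u v n : (forall k, (k <= n)%nat -> u k = v k) -> csum u n = csum v n.
Proof. apply sum_n_ext_loc. Qed.

Lemma Re_csum u n : Re (csum u n) = sum_n (fun k => Re (u k)) n.
Proof.
  induction n.
  - now rewrite csum_0, sum_O.
  - rewrite csum_S, rsum_S, <- IHn. reflexivity.
Qed.

Lemma Im_csum u n : Im (csum u n) = sum_n (fun k => Im (u k)) n.
Proof.
  induction n.
  - now rewrite csum_0, sum_O.
  - rewrite csum_S, rsum_S, <- IHn. reflexivity.
Qed.

Lemma Cmod_csum u n : (Cmod (csum u n) <= sum_n (fun k => Cmod (u k)) n)%R.
Proof.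
  induction n.
  - rewrite csum_0, sum_O. apply Rle_refl.
  - rewrite csum_S, rsum_S. eapply Rle_trans; [apply Cmod_triangle|lra].
Qed.

Lemma csum_plus u v n : csum (fun k => u k + v k) n = csum u n + csum v n.
Proof. induction n; rewrite ?csum_0, ?csum_S; trivial. rewrite IHn; ring. Qed.

Lemma csum_scal (c : C) u n : csum (fun k => c * u k) n = c * csum u n.
Proof. induction n; rewrite ?csum_0, ?csum_S; trivial. rewrite IHn; ring. Qed.

Lemma rsum_le (u v : nat -> R) n :
  (forall k, (k <= n)%nat -> (u k <= v k)%R) -> (sum_n u n <= sum_n v n)%R.
Proof.
  intros H.
  induction n.
  - rewrite !sum_O. apply H; lia.
  - rewrite !rsum_S. apply Rplus_le_compat; [apply IHn; intros; apply H|apply H]; lia.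
Qed.

Lemma rsum_scal (c : R) u n : sum_n (fun k => c * u k)%R n = (c * sum_n u n)%R.
Proof. exact (sum_n_mult_l (K := R_Ring) c u n). Qed.

Lemma rsum_pos (u : nat -> R) n : (forall k, (0 <= u k)%R) -> (0 <= sum_n u n)%R.
Proof.
  intros H; induction n; rewrite ?sum_O, ?rsum_S; auto. specialize (H (S n)); lra.
Qed.

Lemma rsum_ext (u v : nat -> R) n : (forall k, u k = v k) -> sum_n u n = sum_n v n.
Proof. apply sum_n_ext. Qed.

Lemma rsum_shift_le (a b e : nat -> R) N :
  (a O <= b O)%R -> (forall n, (a (S n) <= b (S n) + e n)%R) -> (forall n, (0 <= e n)%R) ->
  (sum_n a N <= sum_n b N + sum_n e N)%R.
Proof.
  intros H0 HS He.
  assert (A : forall N, (sum_n a (S N) <= sum_n b (S N) + sum_n e N)%R).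
  { intros n; induction n.
    - rewrite !rsum_S, !sum_O. specialize (HS O); lra.
    - rewrite (rsum_S a), (rsum_S b), (rsum_S e). specialize (HS (S n)); lra. }
  destruct N.
  - rewrite !sum_O. specialize (He O); lra.
  - specialize (A N). rewrite (rsum_S e). specialize (He (S N)); lra.
Qed.

Lemma INR_S_pos n : (0 < INR (S n))%R.
Proof. apply lt_0_INR; lia. Qed.

Lemma RtoC_INR_S_neq n : RtoC (INR (S n)) <> 0.
Proof. intros E. apply RtoC_inj in E. assert (H := INR_S_pos n). lra. Qed.

Lemma Cmod_inv_INR n : Cmod (/ INR (S n)) = (/ INR (S n))%R.
Proof.
  assert (H := INR_S_pos n).
  rewrite Cmod_inv by apply RtoC_INR_S_neq. rewrite Cmod_R, Rabs_pos_eq; lra.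
Qed.

(** * Limits of complex sequences *)

Definition Clim (u : nat -> C) (l : C) : Prop :=
  is_lim_seq (fun n => Re (u n)) (Re l) /\ is_lim_seq (fun n => Im (u n)) (Im l).

Lemma Clim_ext u v l : (forall n, u n = v n) -> Clim u l -> Clim v l.
Proof.
  intros E [H1 H2]; split.
  - apply is_lim_seq_ext with (fun n => Re (u n)); [intros; now rewrite E | exact H1].
  - apply is_lim_seq_ext with (fun n => Im (u n)); [intros; now rewrite E | exact H2].
Qed.

Lemma Clim_const c : Clim (fun _ => c) c.
Proof. split; apply is_lim_seq_const. Qed.

Lemma Clim_plus u v l m : Clim u l -> Clim v m -> Clim (fun n => u n + v n) (l + m).
Proof. intros [H1 H2] [H3 H4]; split; simpl; now apply is_lim_seq_plus'. Qed.

Lemma Clim_scal (c : C) u l : Clim u l -> Clim (fun n => c * u n) (c * l).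
Proof.
  intros [H1 H2]; split; simpl;
    [apply is_lim_seq_minus' | apply is_lim_seq_plus'];
    apply is_lim_seq_mult'; try apply is_lim_seq_const; assumption.
Qed.

Lemma Clim_minus u v l m : Clim u l -> Clim v m -> Clim (fun n => u n - v n) (l - m).
Proof. intros [H1 H2] [H3 H4]; split; simpl; now apply is_lim_seq_minus'. Qed.

Lemma Clim_unique u l m : Clim u l -> Clim u m -> l = m.
Proof.
  intros [H1 H2] [H3 H4].
  apply is_lim_seq_unique in H1; apply is_lim_seq_unique in H2.
  apply is_lim_seq_unique in H3; apply is_lim_seq_unique in H4.
  rewrite H1 in H3; rewrite H2 in H4.
  injection H3; injection H4; intros A B.
  destruct l, m; simpl in *; now subst.
Qed.

Lemma Clim_incr u l : Clim u l -> Clim (fun n => u (S n)) l.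
Proof.
  intros [H1 H2]; split;
    [apply (is_lim_seq_incr_1 (fun n => Re (u n))) | apply (is_lim_seq_incr_1 (fun n => Im (u n)))];
    assumption.
Qed.

Lemma Rabs_im_le_Cmod c : (Rabs (Im c) <= Cmod c)%R.
Proof. eapply Rle_trans; [apply Rmax_r | apply Rmax_Cmod]. Qed.

Lemma is_lim_seq_0_le (u v : nat -> R) :
  (forall n, (Rabs (u n) <= v n)%R) -> is_lim_seq v 0 -> is_lim_seq u 0.
Proof.
  intros H Hv. apply is_lim_seq_abs_0.
  apply is_lim_seq_le_le with (fun _ => 0%R) v; [|apply is_lim_seq_const|exact Hv].
  intros n; split; [apply Rabs_pos | apply H].
Qed.

Lemma Clim_of_Cmod u l (e : nat -> R) :
  (forall n, (Cmod (u n - l) <= e n)%R) -> is_lim_seq e 0 -> Clim u l.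
Proof.
  intros H He; split.
  - apply is_lim_seq_ext with (fun n => (Re (u n) - Re l) + Re l)%R; [intros; ring|].
    replace (Finite (Re l)) with (Finite (0 + Re l)) by (f_equal; ring). apply is_lim_seq_plus'; [|apply is_lim_seq_const].
    apply is_lim_seq_0_le with e; auto. intros n.
    apply Rle_trans with (2 := H n). apply (re_le_Cmod (u n - l)).
  - apply is_lim_seq_ext with (fun n => (Im (u n) - Im l) + Im l)%R; [intros; ring|].
    replace (Finite (Im l)) with (Finite (0 + Im l)) by (f_equal; ring). apply is_lim_seq_plus'; [|apply is_lim_seq_const].
    apply is_lim_seq_0_le with e; auto. intros n.
    apply Rle_trans with (2 := H n). apply (Rabs_im_le_Cmod (u n - l)).
Qed.

Lemma Clim_0_Cmod u : Clim u 0 <-> is_lim_seq (fun n => Cmod (u n)) 0.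
Proof.
  split.
  - intros [H1 H2]. simpl in *.
    apply is_lim_seq_0_le with (fun n => Rabs (Re (u n)) + Rabs (Im (u n)))%R.
    + intros n. rewrite (Rabs_pos_eq _ (Cmod_ge_0 _)).
      replace (u n) with (Re (u n) + Ci * Im (u n)) at 1
        by (destruct (u n); unfold Cplus, Cmult, Ci, RtoC; simpl; f_equal; ring).
      eapply Rle_trans; [apply Cmod_triangle|].
      rewrite Cmod_mult, !Cmod_R.
      replace (Cmod Ci) with 1%R; [lra|].
      unfold Cmod; simpl. rewrite <- sqrt_1 at 1. f_equal; ring.
    + replace (Finite 0) with (Finite (0 + 0)) by (f_equal; ring). apply is_lim_seq_plus'; now apply is_lim_seq_abs_0 in H1, H2.
  - intros H. apply Clim_of_Cmod with (2 := H). intros n.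
    replace (u n - 0) with (u n) by ring. apply Rle_refl.
Qed.

Lemma Clim_Cmod_le u l (B : R) : Clim u l -> (forall n, (Cmod (u n) <= B)%R) -> (Cmod l <= B)%R.
Proof.
  intros H Hb.
  assert (A : is_lim_seq (fun n => Cmod (l - u n)) 0).
  { apply Clim_0_Cmod. rewrite <- (Cplus_opp_r l).
    apply Clim_minus; [apply Clim_const | exact H]. }
  apply (is_lim_seq_le (fun _ => Cmod l) (fun n => B + Cmod (l - u n))%R (Cmod l) B).
  - intros n. replace l with (u n + (l - u n)) at 1 by ring.
    eapply Rle_trans; [apply Cmod_triangle|]. specialize (Hb n); lra.
  - apply is_lim_seq_const.
  - replace (Finite B) with (Finite (B + 0)) by (f_equal; ring). apply is_lim_seq_plus'; [apply is_lim_seq_const | exact A].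
Qed.

Lemma ex_series_bounded (u : nat -> R) B :
  (forall n, (0 <= u n)%R) -> (forall n, (sum_n u n <= B)%R) -> ex_series u.
Proof.
  intros Hp Hb.
  destruct (ex_finite_lim_seq_incr (sum_n u) B) as [l Hl]; auto.
  - intros n. rewrite rsum_S. specialize (Hp (S n)); lra.
  - exists l. exact Hl.
Qed.

(** Absolute convergence, with boundedness of the partial sums as the
    hypothesis because that is the form in which the estimates come. *)
Lemma Clim_absolute u B :
  (forall n, (sum_n (fun k => Cmod (u k)) n <= B)%R) -> exists l, Clim (csum u) l.
Proof.
  intros H.
  assert (E : ex_series (fun k => Cmod (u k))).
  { apply ex_series_bounded with B; auto. intros; apply Cmod_ge_0. }
  destruct (ex_series_le (fun k => Re (u k)) _ (fun n => re_le_Cmod (u n)) E) as [a Ha].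
  destruct (ex_series_le (fun k => Im (u k)) _ (fun n => Rabs_im_le_Cmod (u n)) E) as [b Hb].
  exists (a, b); split; simpl.
  - apply is_lim_seq_ext with (2 := Ha). intros n; symmetry; exact (Re_csum u n).
  - apply is_lim_seq_ext with (2 := Hb). intros n; symmetry; exact (Im_csum u n).
Qed.

Lemma Clim_ex_Cseries u l : Clim (csum u) l -> ex_Cseries u.
Proof.
  intros [H1 H2]. exists l.
  intros P [eps HP].
  apply is_lim_seq_spec in H1. apply is_lim_seq_spec in H2.
  destruct (H1 eps) as [N1 A1]. destruct (H2 eps) as [N2 A2].
  exists (max N1 N2). intros n Hn. apply HP. split.
  - apply (A1 n). lia.
  - apply (A2 n). lia.
Qed.

Lemma ex_Cseries_Clim u : ex_Cseries u -> exists l, Clim (csum u) l.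
Proof.
  intros [l H]. exists l. split; apply is_lim_seq_spec; intros eps.
  - destruct (H (ball l eps)) as [N A]; [exists eps; auto|]. exists N. intros n Hn. apply (A n Hn).
  - destruct (H (ball l eps)) as [N A]; [exists eps; auto|]. exists N. intros n Hn. apply (A n Hn).
Qed.

Lemma Clim_CSeries u l : Clim (csum u) l -> CSeries u = l.
Proof.
  intros [H1 H2]. unfold CSeries. rewrite (surjective_pairing l). f_equal; apply is_series_unique.
  - apply is_lim_seq_ext with (2 := H1). intros n. exact (Re_csum u n).
  - apply is_lim_seq_ext with (2 := H2). intros n. exact (Im_csum u n).
Qed.

Lemma CSeries_ext u v : (forall n, u n = v n) -> CSeries u = CSeries v.
Proof. intros H. unfold CSeries. f_equal; apply Series_ext; intros n; now rewrite H. Qed.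

Lemma Clim_term_0 u l : Clim (csum u) l -> Clim u 0.
Proof.
  intros H.
  assert (X : Clim (fun n => csum u (S n) - csum u n) 0).
  { rewrite <- (Cplus_opp_r l). exact (Clim_minus _ _ _ _ (Clim_incr _ _ H) H). }
  assert (Y : Clim (fun n => u (S n)) 0).
  { apply Clim_ext with (2 := X). intros n. rewrite csum_S. ring. }
  destruct Y as [Y1 Y2]. split.
  - now apply is_lim_seq_incr_1.
  - now apply is_lim_seq_incr_1.
Qed.

(** * A consequence of the divergence of the harmonic series *)

Lemma ln_step n : (ln (INR (S (S n))) - ln (INR (S n)) <= / INR (S n))%R.
Proof.
  assert (H : (0 < INR (S n))%R) by (apply lt_0_INR; lia).
  rewrite <- ln_div by (try apply lt_0_INR; try lia; auto).
  replace (INR (S (S n)) / INR (S n))%R with (1 + / INR (S n))%R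
    by (rewrite (S_INR (S n)); field; lra).
  assert (H' := Rinv_0_lt_compat _ H).
  rewrite <- (ln_exp (/ INR (S n))) at 2.
  apply ln_le; [lra|]. apply exp_ineq1_le.
Qed.

(** Bounded variation makes w converge, and a positive limit would make
    the sum of w n / (n + 1) diverge with the harmonic series. *)
Lemma harmonic_lim_0 (w : nat -> R) B B' :
  (forall n, (0 <= w n)%R) ->
  (forall n, (sum_n (fun k => Rabs (w (S k) - w k)) n <= B)%R) ->
  (forall n, (sum_n (fun k => / INR (S k) * w k)%R n <= B')%R) ->
  is_lim_seq w 0.
Proof.
  intros Hw Hv Hh.
  assert (E : ex_series (fun k => w (S k) - w k)%R).
  { apply ex_series_Rabs, ex_series_bounded with B; auto. intros; apply Rabs_pos. }
  destruct E as [d Hd].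
  assert (L : is_lim_seq w (d + w O)%R).
  { apply is_lim_seq_incr_1.
    apply is_lim_seq_ext with (fun n => sum_n (fun k => w (S k) - w k)%R n + w O)%R.
    - intros n; induction n; [rewrite sum_O; ring | rewrite rsum_S; lra].
    - apply is_lim_seq_plus'; [exact Hd | apply is_lim_seq_const]. }
  set (l := (d + w O)%R) in *.
  assert (Hl : (0 <= l)%R).
  { apply (is_lim_seq_le (fun _ => 0%R) w 0%R l); auto. apply is_lim_seq_const. }
  destruct (Rle_lt_or_eq_dec _ _ Hl) as [Hpos | <-]; [exfalso | exact L].
  apply is_lim_seq_spec in L.
  assert (Hl2 : (0 < l / 2)%R) by lra.
  destruct (L (mkposreal _ Hl2)) as [N HN]. simpl in HN.
  (* Beyond N the sequence stays above l / 2, and 1 / (k + 1) is at least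
     ln (k + 2) - ln (k + 1). *)
  assert (K : forall n, (l / 2 * (ln (INR (S (S (N + n)))) - ln (INR (S (S N))))
               <= sum_n (fun k => / INR (S k) * w k)%R (N + n))%R).
  { induction n.
    - rewrite Nat.add_0_r. rewrite Rminus_diag, Rmult_0_r.
      apply rsum_pos. intros k. apply Rmult_le_pos; auto.
      left; apply Rinv_0_lt_compat, lt_0_INR; lia.
    - rewrite Nat.add_succ_r, rsum_S.
      assert (X := ln_step (S (N + n))).
      specialize (HN (S (N + n)) ltac:(lia)). apply Rabs_def2 in HN.
      assert (Y : (0 < / INR (S (S (N + n))))%R) by (apply Rinv_0_lt_compat, lt_0_INR; lia).
      nra. }
  destruct (INR_unbounded (exp (2 * B' / l + ln (INR (S (S N)))))) as [n Hn].
  specialize (K n). specialize (Hh (N + n)%nat).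
  assert (A : (2 * B' / l + ln (INR (S (S N))) < ln (INR (S (S (N + n)))))%R).
  { rewrite <- (ln_exp (2 * B' / l + ln (INR (S (S N))))). apply ln_increasing; [apply exp_pos|].
    apply Rlt_le_trans with (1 := Hn). apply le_INR; lia. }
  assert (A' : (l / 2 * (2 * B' / l) < l / 2 * (ln (INR (S (S (N + n)))) - ln (INR (S (S N)))))%R).
  { apply Rmult_lt_compat_l; lra. }
  replace (l / 2 * (2 * B' / l))%R with B' in A' by (field; lra).
  lra.
Qed.

(** * The Taylor series of the principal logarithm *)

Lemma Clog_right w : (0 < Re w)%R ->
  Clog w = (ln (Re w ^ 2 + Im w ^ 2) / 2, atan (Im w / Re w))%R.
Proof.
  intros Hw. destruct w as [a b]; simpl in Hw. unfold Clog, Carg, Cmod; simpl Re; simpl Im; simpl fst; simpl snd.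
  assert (Hp : (0 < a ^ 2 + b ^ 2)%R) by nra.
  f_equal.
  - rewrite <- (sqrt_sqrt (a ^ 2 + b ^ 2)) at 2 by lra.
    rewrite ln_mult by (apply sqrt_lt_R0; lra). field.
  - assert (E : (a / sqrt (a ^ 2 + b ^ 2) = cos (atan (b / a)))%R).
    { rewrite cos_atan. replace (1 + (b / a)²)%R with ((a ^ 2 + b ^ 2) / (a * a))%R
        by (unfold Rsqr; field; lra).
      rewrite sqrt_div_alt by nra. rewrite sqrt_square by lra.
      assert (X := sqrt_lt_R0 _ Hp). field. split; lra. }
    rewrite E. assert (B := atan_bound (b / a)). assert (P := PI_RGT_0).
    destruct (Rle_dec 0 b) as [Hb | Hb].
    + apply acos_cos. split; [|lra]. rewrite <- atan_0.
      destruct Hb as [Hb | <-].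
      * left. apply atan_increasing. apply Rdiv_lt_0_compat; lra.
      * unfold Rdiv. rewrite Rmult_0_l. apply Rle_refl.
    + rewrite <- cos_neg, acos_cos; [ring|]. split; [|lra].
      assert (atan (b / a) < atan 0)%R; [|rewrite atan_0 in *; lra].
      apply atan_increasing. apply Rmult_lt_reg_r with a; auto.
      unfold Rdiv. rewrite Rmult_assoc, Rinv_l, Rmult_0_l by lra. lra.
Qed.

(** The components are those of Clog (1 - t z) as given by [Clog_right]; the
    explicit formula is differentiable without a case split on the sign of the
    imaginary part. *)
Lemma Clog_path_cderiv (z : C) (t : R) : (0 <= t <= 1)%R -> (Cmod z < 1)%R ->
  cderiv (fun t : R => (ln ((1 - t * Re z) ^ 2 + (t * Im z) ^ 2) / 2,
                        atan (- (t * Im z) / (1 - t * Re z)))%R)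
    t (- z / (1 - t * z)).
Proof.
  intros Ht Hz. assert (Hr := re_le_Cmod z). apply Rle_lt_trans with (2 := Hz) in Hr.
  apply Rabs_def2 in Hr. destruct z as [a b]. simpl in *.
  assert (Hpos : (0 < 1 - t * a)%R) by nra.
  assert (Hq : (0 < (1 - t * a) ^ 2 + (t * b) ^ 2)%R) by nra.
  split; simpl; auto_derive; try (repeat split; simpl in *; lra);
    field; repeat split; simpl in *; nra.
Qed.

Lemma geometric_remainder (z : C) N : 1 - z <> 0 ->
  csum (fun n => z ^ n) N = (1 - z ^ S N) / (1 - z).
Proof.
  intros H; induction N.
  - rewrite csum_0. simpl. field. exact H.
  - rewrite csum_S, IHN. simpl. field. exact H.
Qed.

(** The partial sums and the logarithm are compared along the segment from 1 to
    1 - z, where the derivative of their difference is a geometric remainder. *)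
Lemma Clog_series (z : C) : (Cmod z < 1)%R ->
  Clim (csum (fun n => / INR (S n) * z ^ S n)) (- Clog (1 - z)).
Proof.
  intros Hz.
  assert (Hz0 := Cmod_ge_0 z).
  assert (Hre : forall t, (0 <= t <= 1)%R -> (1 - Cmod z <= Cmod (1 - t * z))%R).
  { intros t Ht.
    assert (X := Cmod_triangle (1 - t * z) (t * z)).
    assert (Y : 1 - t * z + t * z = 1) by ring. rewrite Y in X.
    rewrite Cmod_1, Cmod_mult, Cmod_R, Rabs_pos_eq in X by lra. nra. }
  apply Clim_of_Cmod with (fun N => Cmod z ^ S (S N) / (1 - Cmod z))%R.
  - intros N.
    set (L := fun t : R => (ln ((1 - t * Re z) ^ 2 + (t * Im z) ^ 2) / 2,
                        atan (- (t * Im z) / (1 - t * Re z)))%R : C).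
    set (S1 := fun t : R => csum (fun n => / INR (S n) * (t * z) ^ S n) N).
    assert (E1 : Clog (1 - z) = L 1%R).
    { rewrite Clog_right.
      - unfold L; destruct z as [a b]; simpl. f_equal; [do 2 f_equal; ring | f_equal; f_equal; ring].
      - assert (Hr := re_le_Cmod z). apply Rle_lt_trans with (2 := Hz) in Hr.
        apply Rabs_def2 in Hr. destruct z as [a b]; simpl in *; lra. }
    assert (E0 : L 0%R = 0).
    { unfold L. rewrite !Rmult_0_l, Ropp_0, Rminus_0_r. unfold Rdiv at 2.
      rewrite Rmult_0_l, atan_0. replace (1 ^ 2 + 0 ^ 2)%R with 1%R by ring.
      rewrite ln_1. unfold RtoC. f_equal; field. }
    assert (S0 : S1 0%R = 0).
    { unfold S1. rewrite (csum_ext _ (fun n => 0 * 0)).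
      - rewrite csum_scal; ring.
      - intros n _. simpl. ring. }
    assert (Ez : csum (fun n => / INR (S n) * z ^ S n) N = S1 1%R).
    { apply csum_ext; intros n _. f_equal. f_equal. ring. }
    replace (csum (fun n => / INR (S n) * z ^ S n) N - - Clog (1 - z))
      with ((S1 1%R + L 1%R) - (S1 0%R + L 0%R)) by (rewrite Ez, E1, E0, S0; ring).
    replace (Cmod z ^ S (S N) / (1 - Cmod z))%R
      with (1 * (Cmod z ^ S (S N) / (1 - Cmod z)) - 0 * (Cmod z ^ S (S N) / (1 - Cmod z)))%R by ring.
    apply (cderiv_le (fun t : R => S1 t + L t)
      (fun t => z * csum (fun n => (t * z) ^ n) N + - z / (1 - t * z))
      (fun t => t * (Cmod z ^ S (S N) / (1 - Cmod z)))%R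
      (fun t => (Cmod z ^ S (S N) / (1 - Cmod z)))%R); [lra | | |].
    + intros t Ht. apply cderiv_plus; [|now apply Clog_path_cderiv].
      unfold S1. clear -N. induction N.
      * apply (cderiv_ext (fun t : R => t * z) _ t z).
        -- intros u; rewrite csum_0. simpl. field.
        -- rewrite csum_0; simpl; ring.
        -- apply cderiv_line.
      * apply (cderiv_ext (fun t : R => csum (fun n => / INR (S n) * (t * z) ^ S n) N
                            + z ^ S (S N) * ((/ INR (S (S N)) * t ^ S (S N))%R)) _ t
                (z * csum (fun n => (t * z) ^ n) N + z ^ S (S N) * (t ^ S N)%R)).
        -- intros u. rewrite csum_S, Cpow_mult_l, RtoC_mult, RtoC_inv, RtoC_pow
             by (apply not_0_INR; lia). ring.
        -- rewrite csum_S, Cpow_mult_l, RtoC_pow. simpl. ring.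
        -- apply cderiv_plus; [exact IHN|]. apply cderiv_scal.
           split.
           ++ change (is_derive (fun u => / INR (S (S N)) * u ^ S (S N))%R t (t ^ S N)%R).
              replace (t ^ S N)%R with (/ INR (S (S N)) * (INR (S (S N)) * 1 * t ^ pred (S (S N))))%R
                by (change (pred (S (S N))) with (S N); field; apply not_0_INR; lia).
              apply is_derive_scal.
              apply (is_derive_pow (fun u => u) (S (S N)) t 1%R).
              apply (is_derive_id (K := R_AbsRing)).
           ++ exact (is_derive_const (V := R_NormedModule) 0%R t).
    + intros t Ht. generalize (Cmod z ^ S (S N) / (1 - Cmod z))%R; intros K.
      auto_derive; trivial; ring.
    + intros t Ht.
      assert (Hd := Hre t Ht).
      assert (Hn : 1 - t * z <> 0) by (apply Cmod_gt_0; lra).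
      rewrite geometric_remainder by assumption.
      replace (z * ((1 - (t * z) ^ S N) / (1 - t * z)) + - z / (1 - t * z))
        with (- (z * (t * z) ^ S N / (1 - t * z))) by (field; assumption).
      rewrite Cmod_opp, Cmod_div by assumption.
      unfold Rdiv. apply Rmult_le_compat.
      * apply Cmod_ge_0.
      * left; apply Rinv_0_lt_compat; lra.
      * rewrite Cmod_mult, Cmod_pow, Cmod_mult, Cmod_R, Rabs_pos_eq by lra.
        change (Cmod z ^ S (S N))%R with (Cmod z * Cmod z ^ S N)%R.
        apply Rmult_le_compat_l; [assumption|].
        apply pow_incr; split; [apply Rmult_le_pos; lra | nra].
      * apply Rinv_le_contravar; lra.
  - unfold Rdiv.
    replace (Finite 0) with (Finite (0 * / (1 - Cmod z))) by (f_equal; ring).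
    apply is_lim_seq_mult'; [|apply is_lim_seq_const].
    apply (is_lim_seq_incr_1 (fun n => Cmod z ^ S n)%R).
    apply (is_lim_seq_incr_1 (fun n => Cmod z ^ n)%R).
    apply is_lim_seq_geom. rewrite Rabs_pos_eq; lra.
Qed.

(** * The logarithmic series of a tower *)

(** The partial sums of the expansion of - log (y E), applied to a at 0. *)
Definition logsum (y : C) (M : nat) (a : nat -> C) : C :=
  csum (fun n => / INR (S n) * D y (S n) a 0) M.

Lemma logsum_ext y M a b : (forall k, a k = b k) -> logsum y M a = logsum y M b.
Proof. intros H. apply csum_ext; intros. f_equal. now apply D_ext. Qed.

(** Differentiating f (x + k v) in v brings down the index k, and [D_weight]
    removes it again. *)
Lemma sample_step_cderiv y f g n m x v : tower f g -> (0 <= x)%R -> (0 <= v)%R ->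
  cderiv (fun v => D y (S n) (sample (f m) x v) 0) v
    (INR (S n) * (y * D y n (sample (f (S m)) x v) 1)).
Proof.
  intros T Hx Hv.
  apply (cderiv_ext _ _ _ (D y (S n) (fun k => (INR k + 0) * - sample (f (S m)) x v k) 0)
    (INR (S n) * (y * D y n (sample (f (S m)) x v) 1)) (fun _ => eq_refl)).
  - rewrite D_weight, !D_opp. simpl (INR 0). ring.
  - apply D_cderiv. intros k. unfold sample.
    assert (Hp : (0 <= x + INR k * v)%R) by (assert (H := pos_INR k); nra).
    rewrite Cplus_0_r. apply (cderiv_comp_affine (f m)). now apply T.
Qed.

(** By [sample_step_cderiv] the derivative of the n-th term is
    y E (1 - y E)^n, the difference of two consecutive powers of 1 - y E, so the
    sum telescopes. *)
Lemma logsum_cderiv y f g M x v : tower f g -> (0 <= x)%R -> (0 <= v)%R ->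
  cderiv (fun v => logsum y M (sample (f 0%nat) x v)) v
    (f 1%nat x - D y (S M) (sample (f 1%nat) x v) 0).
Proof.
  intros T Hx Hv.
  assert (A : forall n, cderiv (fun v => / INR (S n) * D y (S n) (sample (f 0%nat) x v) 0) v
     (D y n (sample (f 1%nat) x v) 0 - D y (S n) (sample (f 1%nat) x v) 0)).
  { intros n.
    apply (cderiv_ext _ _ _ (/ INR (S n) * (INR (S n) * (y * D y n (sample (f 1%nat) x v) 1)))
       _ (fun _ => eq_refl)).
    - cbn [D]. field. apply (not_eq_sym). intros E. apply RtoC_inj in E.
      apply (not_0_INR (S n)); auto.
    - apply cderiv_scal. now apply sample_step_cderiv with g. }
  induction M.
  - apply (cderiv_ext (fun v => / INR 1 * D y 1 (sample (f 0%nat) x v) 0) _ _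
      (D y 0 (sample (f 1%nat) x v) 0 - D y 1 (sample (f 1%nat) x v) 0)).
    + intros t; unfold logsum. now rewrite csum_0.
    + simpl. unfold sample at 1. do 2 f_equal. simpl; ring.
    + apply A.
  - apply (cderiv_ext (fun v => logsum y M (sample (f 0%nat) x v)
             + / INR (S (S M)) * D y (S (S M)) (sample (f 0%nat) x v) 0) _ _
      (f 1%nat x - D y (S M) (sample (f 1%nat) x v) 0
        + (D y (S M) (sample (f 1%nat) x v) 0 - D y (S (S M)) (sample (f 1%nat) x v) 0))).
    + intros t; unfold logsum. now rewrite csum_S.
    + ring.
    + apply cderiv_plus; auto.
Qed.

(** The bound of [tower_dominates] at y = theta, where 1 - |1 - theta| is theta
    itself, is a majorant of a modulus. *)
Lemma tower_DR_pos th f g n m x v : tower f g -> (0 <= th <= 1)%R -> (0 <= x)%R -> (0 <= v)%R ->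
  (0 <= DR th n (sample (g m) x v) 0)%R.
Proof.
  intros T Hth Hx Hv.
  assert (X := tower_dominates (RtoC th) _ _ T n m x v Hx Hv).
  rewrite <- RtoC_minus, Cmod_R, Rabs_pos_eq in X by lra.
  replace (1 - (1 - th))%R with th in X by ring.
  eapply Rle_trans; [apply Cmod_ge_0 | exact X].
Qed.

(** Widening the step increases the differences of a completely monotone
    function: the derivative in v is again such a difference. *)
Lemma DR_sample_mono th f g n m x v : tower f g -> (0 <= th <= 1)%R -> (0 <= x)%R -> (0 <= v <= 1)%R ->
  (DR th n (sample (g m) x v) 0 <= DR th n (sample (g m) x 1) 0)%R.
Proof.
  intros T Hth Hx Hv. destruct n as [|n].
  - unfold DR, sample; simpl. rewrite !Rmult_0_l. apply Rle_refl.
  - assert (X := is_derive_le (fun _ => 0)%R (fun v => DR th (S n) (sample (g m) x v) 0)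
      (fun _ => 0)%R (fun v => INR (S n) * (th * DR th n (sample (g (S m)) x v) 1))%R v 1).
    cbv beta in X. assert (0 - 0 <= DR th (S n) (sample (g m) x 1) 0 - DR th (S n) (sample (g m) x v) 0)%R; [|lra].
    apply X; [lra| | |].
    + intros t _. exact (is_derive_const (V := R_NormedModule) 0%R t).
    + intros t Ht.
      assert (Y := sample_step_cderiv th _ _ n m x t (tower_real f g T) Hx ltac:(lra)).
      destruct Y as [Y _]. rewrite re_scal_l, re_scal_l in Y. exact Y.
    + intros t Ht. rewrite DR_sample_S.
      apply Rmult_le_pos; [apply pos_INR|]. apply Rmult_le_pos; [lra|].
      apply tower_DR_pos with f; auto; lra.
Qed.

(** [logsum_cderiv] is integrated over the steps v between 0, where the sampled
    sequence is constant, and 1. The remainder is bounded by that of the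
    majorant, which is largest at v = 1. *)
Lemma tower_log_error y f g M x : tower f g -> (Cmod (1 - y) <= 1)%R -> (0 <= x)%R ->
  (Cmod (logsum y M (sample (f 0%nat) x 1) - logsum y M (fun _ => f 0%nat x) - f 1%nat x)
   <= DR (1 - Cmod (1 - y)) (S M) (sample (g 1%nat) x 1) 0)%R.
Proof.
  intros T Hy Hx.
  assert (Hth : (0 <= 1 - Cmod (1 - y) <= 1)%R) by (assert (X := Cmod_ge_0 (1 - y)); lra).
  set (e := DR _ (S M) (sample (g 1%nat) x 1) 0).
  assert (X := cderiv_le (fun v : R => logsum y M (sample (f 0%nat) x v) - v * f 1%nat x)
    (fun v => f 1%nat x - D y (S M) (sample (f 1%nat) x v) 0 - f 1%nat x)
    (fun v => v * e)%R (fun _ => e) 0 1 ltac:(lra)).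
  assert (E : logsum y M (fun _ => f 0%nat x) = logsum y M (sample (f 0%nat) x 0)).
  { apply logsum_ext. intros k; unfold sample. f_equal; ring. }
  rewrite E.
  replace (logsum y M (sample (f 0%nat) x 1) - logsum y M (sample (f 0%nat) x 0) - f 1%nat x)
    with (logsum y M (sample (f 0%nat) x 1) - 1 * f 1%nat x
          - (logsum y M (sample (f 0%nat) x 0) - 0 * f 1%nat x)) by ring.
  replace e with (1 * e - 0 * e)%R by ring.
  apply X.
  - intros t Ht. apply cderiv_minus; [|apply cderiv_line]. apply logsum_cderiv with g; auto; lra.
  - intros t _. auto_derive; trivial; ring.
  - intros t Ht.
    replace (f 1%nat x - D y (S M) (sample (f 1%nat) x t) 0 - f 1%nat x)
      with (- D y (S M) (sample (f 1%nat) x t) 0) by ring.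
    rewrite Cmod_opp. eapply Rle_trans; [apply tower_dominates with (1 := T); lra|].
    apply DR_sample_mono with f; auto; lra.
Qed.

Lemma geometric_sum_le q N : (0 <= q < 1)%R -> (sum_n (fun n => q ^ S n) N <= / (1 - q))%R.
Proof.
  intros Hq.
  assert (E : (sum_n (fun n => q ^ S n) N = (q - q ^ S (S N)) / (1 - q))%R).
  { induction N.
    - rewrite sum_O. simpl. field. lra.
    - rewrite rsum_S, IHN. simpl. field. lra. }
  rewrite E. unfold Rdiv. rewrite <- (Rmult_1_l (/ (1 - q))) at 2.
  apply Rmult_le_compat_r; [left; apply Rinv_0_lt_compat; lra|].
  assert (X := pow_le q (S (S N)) ltac:(lra)). lra.
Qed.

(** For the majorant the remainder in [logsum_cderiv] is nonnegative and can be
    dropped; at v = 0 the sum is dominated by a geometric series. This replaces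
    any estimate of the decay of the differences in n. *)
Lemma tower_log_bound th f g M x : tower f g -> (0 < th <= 1)%R -> (0 <= x)%R ->
  (sum_n (fun n => / INR (S n) * DR th (S n) (sample (g 0%nat) x 1) 0) M
   <= g 0%nat x / th + g 1%nat x)%R.
Proof.
  intros T Hth Hx.
  assert (TR := tower_real f g T).
  assert (ER : forall v, Re (logsum th M (sample (fun x => RtoC (g 0%nat x)) x v))
     = sum_n (fun n => / INR (S n) * DR th (S n) (sample (g 0%nat) x v) 0)%R M).
  { intros v. unfold logsum. rewrite Re_csum. apply sum_n_ext. intros n.
    rewrite <- RtoC_inv by (apply not_0_INR; lia). apply re_scal_l. }
  assert (X := is_derive_le
    (fun v => Re (logsum th M (sample (fun x => RtoC (g 0%nat x)) x v)))
    (fun v => v * g 1%nat x)%R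
    (fun v => g 1%nat x - DR th (S M) (sample (g 1%nat) x v) 0)%R
    (fun _ => g 1%nat x) 0 1 ltac:(lra)).
  cbv beta in X. rewrite !ER in X.
  assert (X' : (sum_n (fun n => / INR (S n) * DR th (S n) (sample (g 0%nat) x 1) 0) M -
    sum_n (fun n => / INR (S n) * DR th (S n) (sample (g 0%nat) x 0) 0) M <= 1 * g 1%nat x - 0 * g 1%nat x)%R).
  { apply X.
    - intros t Ht. exact (proj1 (logsum_cderiv th _ _ M x t TR Hx ltac:(lra))).
    - intros t _. auto_derive; trivial; ring.
    - intros t Ht. assert (Y := tower_DR_pos th f g (S M) 1 x t T ltac:(lra) Hx ltac:(lra)). lra. }
  assert (Z : (sum_n (fun n => / INR (S n) * DR th (S n) (sample (g 0%nat) x 0) 0) M <= g 0%nat x / th)%R).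
  { assert (Hg : (0 <= g 0%nat x)%R) by (eapply Rle_trans; [apply Cmod_ge_0 | apply T; auto]).
    apply Rle_trans with (sum_n (fun n => g 0%nat x * (1 - th) ^ S n)%R M).
    - apply rsum_le. intros n _.
      replace (DR th (S n) (sample (g 0%nat) x 0) 0) with ((1 - th) ^ S n * g 0%nat x)%R.
      + assert (P : (0 <= (1 - th) ^ S n)%R) by (apply pow_le; lra).
        assert (Q : (/ INR (S n) <= 1)%R).
        { apply Rle_trans with (/ 1)%R; [|rewrite Rinv_1; lra].
          apply Rinv_le_contravar; [lra|]. rewrite S_INR.
          assert (R := pos_INR n); lra. }
        assert (R := Rmult_le_pos _ _ P Hg). nra.
      + unfold DR. rewrite (D_ext th (S n) _ (fun _ => RtoC (g 0%nat x))).
        * rewrite D_const, <- RtoC_minus, <- RtoC_pow, re_scal_l. reflexivity.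
        * intros j. unfold sample. do 2 f_equal. ring.
    - rewrite rsum_scal. unfold Rdiv. apply Rmult_le_compat_l; auto.
      replace (/ th)%R with (/ (1 - (1 - th)))%R by (f_equal; ring).
      apply geometric_sum_le. lra. }
  lra.
Qed.

(** The differences decrease in n, and by [tower_log_bound] their harmonic sum
    is bounded, so [harmonic_lim_0] applies. *)
Lemma tower_DR_lim_0 th f g x : tower f g -> (0 < th <= 1)%R -> (0 <= x)%R ->
  is_lim_seq (fun n => DR th n (sample (g 0%nat) x 1) 0) 0.
Proof.
  intros T Hth Hx.
  assert (P : forall n x, (0 <= x)%R -> (0 <= DR th n (sample (g 0%nat) x 1) 0)%R).
  { intros; apply tower_DR_pos with f; auto; lra. }
  apply is_lim_seq_incr_1.
  assert (Dec : forall n, (DR th (S n) (sample (g 0%nat) x 1) 0 <= DR th n (sample (g 0%nat) x 1) 0)%R).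
  { intros n. rewrite DR_S, DR_sample_S. assert (Y := P n (x + 1)%R ltac:(lra)). nra. }
  apply harmonic_lim_0 with (DR th 1 (sample (g 0%nat) x 1) 0) (g 0%nat x / th + g 1%nat x)%R.
  - intros; now apply P.
  - intros n. apply Rle_trans with (DR th 1 (sample (g 0%nat) x 1) 0 - DR th (S (S n)) (sample (g 0%nat) x 1) 0)%R.
    + right. induction n.
      * rewrite sum_O, Rabs_minus_sym, Rabs_pos_eq; [lra|]. specialize (Dec 1%nat); lra.
      * rewrite rsum_S, IHn, Rabs_minus_sym, Rabs_pos_eq; [ring|]. specialize (Dec (S (S n))); lra.
    + assert (Y := P (S (S n)) x Hx). lra.
  - intros n. apply tower_log_bound with f; auto.
Qed.

Lemma tower_log_limit y f g x : tower f g -> (Cmod (1 - y) < 1)%R -> (0 <= x)%R ->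
  Clim (fun M => logsum y M (sample (f 0%nat) x 1)) (f 1%nat x - Clog y * f 0%nat x).
Proof.
  intros T Hy Hx.
  assert (Hth : (0 < 1 - Cmod (1 - y) <= 1)%R) by (assert (X := Cmod_ge_0 (1 - y)); lra).
  assert (A : Clim (fun M => logsum y M (fun _ => f 0%nat x)) (- Clog y * f 0%nat x)).
  { apply Clim_ext with (fun M => f 0%nat x * csum (fun n => / INR (S n) * (1 - y) ^ S n) M).
    - intros M. rewrite <- csum_scal. apply csum_ext. intros n _. rewrite D_const. ring.
    - replace (- Clog y * f 0%nat x) with (f 0%nat x * - Clog (1 - (1 - y))).
      + apply Clim_scal, Clog_series, Hy.
      + replace (1 - (1 - y)) with y by ring. ring. }
  assert (B : Clim (fun M => logsum y M (sample (f 0%nat) x 1) - logsum y M (fun _ => f 0%nat x)) (f 1%nat x)).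
  { apply Clim_of_Cmod with (fun M => DR (1 - Cmod (1 - y)) (S M) (sample (g 1%nat) x 1) 0).
    - intros M. apply tower_log_error; auto; lra.
    - apply (is_lim_seq_incr_1 (fun M => DR (1 - Cmod (1 - y)) M (sample (g 1%nat) x 1) 0)).
      exact (tower_DR_lim_0 _ _ _ x (tower_tail f g T) Hth Hx). }
  replace (f 1%nat x - Clog y * f 0%nat x) with (f 1%nat x + - Clog y * f 0%nat x) by ring.
  apply Clim_ext with (2 := Clim_plus _ _ _ _ B A). intros; ring.
Qed.

(** * Weighted summability *)

(** The power n^m is kept apart from the factor 1 / (n + 1) of the series, so
    that the weight at m = 0 is that factor itself. *)
Definition weight (m n : nat) : R := (INR (S n) ^ m * / INR (S n))%R.

Lemma weight_pos m n : (0 < weight m n)%R.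
Proof.
  assert (H := INR_S_pos n). apply Rmult_lt_0_compat; [now apply pow_lt | now apply Rinv_0_lt_compat].
Qed.

Lemma weight_0 n : weight 0 n = (/ INR (S n))%R.
Proof. unfold weight; simpl pow. ring. Qed.

Lemma weight_S m n : weight (S m) n = (INR (S n) ^ m)%R.
Proof. assert (H := INR_S_pos n). unfold weight. cbn [pow]. field. lra. Qed.

(** Bernoulli's inequality, in the form required by summation by parts against
    the weights. *)
Lemma pow_difference_le m X : (1 <= X)%R -> (X ^ m - (X - 1) ^ m <= INR (S m) * (X ^ m * / X))%R.
Proof.
  intros HX.
  assert (B : (X ^ m * (X - INR (S m)) <= X * (X - 1) ^ m)%R).
  { induction m.
    - simpl. lra.
    - assert (P : (0 <= X ^ m)%R) by (apply pow_le; lra).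
      assert (Q := Rmult_le_compat_r (X - 1) _ _ ltac:(lra) IHm).
      assert (R := pos_INR m). rewrite (S_INR (S m)). rewrite S_INR in *. cbn [pow]. nra. }
  apply Rmult_le_reg_r with X; [lra|].
  replace (INR (S m) * (X ^ m * / X) * X)%R with (INR (S m) * X ^ m)%R by (field; lra).
  nra.
Qed.

(** Summation by parts: a power of n against the decrements of d costs one
    power less against d itself. *)
Lemma weighted_decrease (d : nat -> R) m N : (forall n, (0 <= d n)%R) ->
  (sum_n (fun n => INR (S n) ^ m * (d n - d (S n))) N <= INR (S m) * sum_n (fun n => weight m n * d n) N)%R.
Proof.
  intros Hd.
  assert (A : (sum_n (fun n => INR (S n) ^ m * (d n - d (S n))) N + INR (S N) ^ m * d (S N)
              <= INR (S m) * sum_n (fun n => weight m n * d n) N)%R).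
  { induction N.
    - rewrite !sum_O. unfold weight. simpl (INR 1). rewrite pow1, Rinv_1.
      assert (H := pos_INR m). specialize (Hd O). rewrite S_INR. nra.
    - rewrite !rsum_S.
      assert (X := pow_difference_le m (INR (S (S N)))).
      assert (Y : (1 <= INR (S (S N)))%R) by (rewrite S_INR; assert (H := INR_S_pos N); lra).
      specialize (X Y).
      replace (INR (S (S N)) - 1)%R with (INR (S N)) in X by (rewrite (S_INR (S N)); ring).
      fold (weight m (S N)) in X.
      assert (Z := Rmult_le_compat_r _ _ _ (Hd (S N)) X). nra. }
  assert (B : (0 <= INR (S N) ^ m * d (S N))%R).
  { apply Rmult_le_pos; auto. apply pow_le, pos_INR. }
  lra.
Qed.

(** Since theta E (1 - theta E)^n is a difference of consecutive powers,
    moving x up by one gains a power of n by [weighted_decrease]. The case m = 0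
    is [tower_log_bound]. *)
Lemma tower_weighted_bound th f g : tower f g -> (0 < th <= 1)%R -> forall m, exists K, (0 <= K)%R /\
  forall x N, (0 <= x)%R ->
  (sum_n (fun n => weight m n * DR th n (sample (g 0%nat) (x + INR m) 1) 0) N
   <= K * (g 0%nat x + g 1%nat x))%R.
Proof.
  intros T Hth.
  assert (P : forall n x, (0 <= x)%R -> (0 <= DR th n (sample (g 0%nat) x 1) 0)%R).
  { intros; apply tower_DR_pos with f; auto; lra. }
  assert (G : forall m x, (0 <= x)%R -> (0 <= g m x)%R).
  { intros m x Hx. eapply Rle_trans; [apply Cmod_ge_0 | now apply T]. }
  assert (It := Rinv_0_lt_compat th ltac:(lra)).
  induction m as [|m [K [HK IH]]].
  - exists (1 + / th)%R. split; [lra|]. intros x N Hx.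
    simpl INR. rewrite Rplus_0_r.
    set (b := fun n => match n with O => g 0%nat x | S _ => 0%R end).
    assert (Eb : sum_n b N = g 0%nat x).
    { induction N; [now rewrite sum_O | rewrite rsum_S, IHN; simpl; ring]. }
    assert (B : (sum_n (fun n => weight 0 n * DR th n (sample (g 0%nat) x 1) 0) N
      <= sum_n b N + sum_n (fun n => / INR (S n) * DR th (S n) (sample (g 0%nat) x 1) 0) N)%R).
    { apply rsum_shift_le.
      - rewrite weight_0. simpl (INR 1). rewrite Rinv_1. unfold DR, sample; simpl.
        rewrite Rmult_0_l, Rplus_0_r. lra.
      - intros n. rewrite weight_0. simpl b. rewrite Rplus_0_l.
        apply Rmult_le_compat_r; auto. apply Rinv_le_contravar; [apply INR_S_pos|]. apply le_INR; lia.
      - intros n. apply Rmult_le_pos; auto. left; apply Rinv_0_lt_compat, INR_S_pos. }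
    assert (X := tower_log_bound th f g N x T Hth Hx).
    assert (G0 := G 0%nat x Hx). assert (G1 := G 1%nat x Hx). unfold Rdiv in X. nra.
  - exists (/ th * (INR (S m) * K))%R. split.
    { apply Rmult_le_pos; [lra|]. apply Rmult_le_pos; [apply pos_INR | exact HK]. }
    intros x N Hx.
    assert (Hxm : (0 <= x + INR m)%R) by (assert (H := pos_INR m); lra).
    set (d := fun n => DR th n (sample (g 0%nat) (x + INR m) 1) 0).
    replace (sum_n (fun n => weight (S m) n * DR th n (sample (g 0%nat) (x + INR (S m)) 1) 0)%R N)
      with (/ th * sum_n (fun n => INR (S n) ^ m * (d n - d (S n))) N)%R.
    + rewrite !Rmult_assoc. apply Rmult_le_compat_l; [lra|].
      eapply Rle_trans; [apply weighted_decrease; intros; now apply P|].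
      apply Rmult_le_compat_l; [apply pos_INR|]. now apply IH.
    + rewrite <- rsum_scal. apply rsum_ext. intros n. rewrite weight_S. unfold d.
      rewrite DR_S, DR_sample_S, (S_INR m), Rplus_assoc. field. lra.
Qed.

(** * Hasse-summable sequences *)

(** The class of sequences for which the argument works, c' being the sequence
    of derivatives of a function that interpolates c, of size (x + 1)^(- r).
    The case m = 0 controls the summation; multiplication by x + 1 turns the
    bound for m + 1 into the one for m, hence the quantifier. *)
Definition hasse_summable (y : C) (r : R) (c c' : nat -> C) : Prop :=
  (forall m, exists K, (0 <= K)%R /\ forall x N, (m <= x)%nat ->
     (sum_n (fun n => weight m n * Cmod (D y n c x)) N <= K * Rpower (INR (S x)) (- r))%R) /\
  (forall x, Clim (csum (fun n => / INR (S n) * D y (S n) c x)) (- Clog y * c x - c' x)).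

Lemma hasse_ext y r r' c c' b b' : r = r' -> (forall k, c k = b k) -> (forall k, c' k = b' k) ->
  hasse_summable y r c c' -> hasse_summable y r' b b'.
Proof.
  intros <- Ec Ec' [H1 H2]; split.
  - intros m. destruct (H1 m) as [K [HK H]]. exists K; split; auto. intros x N Hm.
    rewrite (sum_n_ext _ (fun n => weight m n * Cmod (D y n c x))%R); auto.
    intros n. now rewrite (D_ext y n c b x Ec).
  - intros x. rewrite <- Ec, <- Ec'. apply Clim_ext with (2 := H2 x).
    intros n. apply csum_ext. intros k _. now rewrite (D_ext y (S k) c b x Ec).
Qed.

Lemma Rpower_neg_le_scaled r X Y s : (0 <= r)%R -> (0 < s)%R -> (0 < X)%R -> (0 < Y)%R -> (Y <= s * X)%R ->
  (Rpower X (- r) <= Rpower s r * Rpower Y (- r))%R.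
Proof.
  intros Hr Hs HX HY H.
  rewrite !Rpower_Ropp.
  assert (A : (Rpower Y r <= Rpower s r * Rpower X r)%R).
  { rewrite Rpower_mult_distr by assumption. apply Rle_Rpower_l; lra. }
  assert (B : (0 < Rpower X r)%R) by apply exp_pos.
  assert (B' : (0 < Rpower Y r)%R) by apply exp_pos.
  apply Rmult_le_reg_r with (Rpower X r * Rpower Y r)%R; [nra|].
  field_simplify; lra.
Qed.

(** The weighted bound holds at x + m in terms of the majorant at x; going back
    to x costs a constant because x + 1 <= (m + 1) (x - m + 1). *)
Lemma tower_hasse y f g r A : tower f g -> (Cmod (1 - y) < 1)%R -> (0 <= r)%R -> (0 <= A)%R ->
  (forall x, (0 <= x)%R -> (g 0%nat x + g 1%nat x <= A * Rpower (x + 1) (- r))%R) ->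
  hasse_summable y r (fun k => f 0%nat (INR k)) (fun k => - f 1%nat (INR k)).
Proof.
  intros T Hy Hr HA Hg.
  assert (Hth : (0 < 1 - Cmod (1 - y) <= 1)%R) by (assert (X := Cmod_ge_0 (1 - y)); lra).
  assert (E : forall n x, D y n (fun k => f 0%nat (INR k)) x = D y n (sample (f 0%nat) (INR x) 1) 0).
  { intros n x. rewrite D_shift_n. apply D_ext. intros j. unfold sample.
    f_equal. rewrite plus_INR. ring. }
  split.
  - intros m. destruct (tower_weighted_bound _ f g T Hth m) as [K [HK H]].
    exists (K * (A * Rpower (INR (S m)) r))%R. split.
    { repeat apply Rmult_le_pos; auto. left; apply exp_pos. }
    intros x N Hm.
    assert (Ex : INR x = (INR (x - m) + INR m)%R) by (rewrite <- plus_INR; f_equal; lia).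
    eapply Rle_trans; [|eapply Rle_trans; [apply (H (INR (x - m)) N (pos_INR _))|]].
    + apply rsum_le. intros n _. rewrite E, Ex. apply Rmult_le_compat_l; [left; apply weight_pos|].
      apply tower_dominates; auto; [|lra]. apply Rplus_le_le_0_compat; apply pos_INR.
    + rewrite Rmult_assoc. apply Rmult_le_compat_l; auto.
      eapply Rle_trans; [apply Hg, pos_INR|]. rewrite Rmult_assoc.
      apply Rmult_le_compat_l; auto. rewrite <- S_INR.
      apply Rpower_neg_le_scaled; auto; try apply INR_S_pos.
      rewrite <- mult_INR. apply le_INR. nia.
  - intros x. replace (- Clog y * f 0%nat (INR x) - - f 1%nat (INR x))
      with (f 1%nat (INR x) - Clog y * f 0%nat (INR x)) by ring.
    apply Clim_ext with (2 := tower_log_limit y f g (INR x) T Hy (pos_INR x)).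
    intros M. apply csum_ext. intros n _. now rewrite E.
Qed.

(** The case m = 1 at x + 1 bounds the variation of the terms and the case
    m = 0 their harmonic sum, so [harmonic_lim_0] applies. *)
Lemma hasse_term_lim_0 y r c c' x : hasse_summable y r c c' ->
  Clim (fun n => D y n c x) 0.
Proof.
  intros [H1 _]. apply Clim_0_Cmod.
  destruct (H1 0%nat) as [K0 [_ HK0]]. destruct (H1 1%nat) as [K1 [_ HK1]].
  apply harmonic_lim_0 with (Cmod y * (K1 * Rpower (INR (S (S x))) (- r)))%R
    (K0 * Rpower (INR (S x)) (- r))%R.
  - intros; apply Cmod_ge_0.
  - intros N. eapply Rle_trans; [|apply Rmult_le_compat_l; [apply Cmod_ge_0 | apply (HK1 (S x) N); lia]].
    rewrite <- rsum_scal. apply rsum_le. intros n _.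
    rewrite weight_S. simpl pow. rewrite Rmult_1_l, <- Cmod_mult.
    replace (y * D y n c (S x)) with (- (D y (S n) c x - D y n c x)) by (simpl; ring).
    rewrite Cmod_opp.
    set (a := D y (S n) c x). set (b := D y n c x).
    assert (X := Cmod_triangle (a - b) b). assert (Y := Cmod_triangle (b - a) a).
    replace (a - b + b) with a in X by ring. replace (b - a + a) with b in Y by ring.
    replace (b - a) with (- (a - b)) in Y by ring. rewrite Cmod_opp in Y.
    apply Rabs_le. lra.
  - intros N. rewrite (rsum_ext _ (fun k => weight 0 k * Cmod (D y k c x))%R).
    + apply HK0; lia.
    + intros k. now rewrite weight_0.
Qed.

Lemma Rpower_shift_le r x : (Rpower (INR (S (S x))) (- r) <= exp (Rabs r) * Rpower (INR (S x)) (- r))%R.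
Proof.
  assert (H := INR_S_pos x). assert (H' := INR_S_pos (S x)).
  unfold Rpower. rewrite <- exp_plus. 
  assert (A : (0 <= ln (INR (S (S x))) - ln (INR (S x)) <= 1)%R).
  { split.
    - assert (X : (ln (INR (S x)) <= ln (INR (S (S x))))%R) by (apply ln_le; auto; apply le_INR; lia). lra.
    - eapply Rle_trans; [apply ln_step|]. rewrite <- Rinv_1. apply Rinv_le_contravar; [lra|].
      rewrite S_INR. assert (Y := pos_INR x). lra. }
  assert (B : (- r * ln (INR (S (S x))) <= Rabs r + - r * ln (INR (S x)))%R).
  { assert (X := Rle_abs (- r)). rewrite Rabs_Ropp in X. assert (Y := Rabs_pos r). nra. }
  destruct B as [B | ->]; [left; now apply exp_increasing | apply Rle_refl].
Qed.

Lemma weight_succ m n : (INR (S n) * weight m (S n) <= 2 ^ m * weight (S m) n)%R.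
Proof.
  rewrite weight_S. unfold weight. rewrite <- Rpow_mult_distr.
  assert (H := INR_S_pos n). assert (H' := INR_S_pos (S n)).
  apply Rle_trans with (INR (S (S n)) ^ m)%R.
  - assert (P : (0 <= INR (S (S n)) ^ m)%R) by (apply pow_le; lra).
    apply Rmult_le_reg_r with (INR (S (S n))); auto.
    replace (INR (S n) * (INR (S (S n)) ^ m * / INR (S (S n))) * INR (S (S n)))%R
      with (INR (S (S n)) ^ m * INR (S n))%R by (field; lra).
    apply Rmult_le_compat_l; auto. apply le_INR; lia.
  - apply pow_incr. rewrite (S_INR (S n)) in *. rewrite S_INR in *. assert (Y := pos_INR n). lra.
Qed.

(** The step from exponent sigma to sigma - 1. By [D_weight] the new
    differences are (x + 1) D_n (x) - n y D_(n - 1) (x + 1). In the logarithmic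
    series the second part is a telescoping sum with value c x, the extra term
    in the derivative of (x + 1) c. *)
Lemma hasse_shift y r c c' : hasse_summable y r c c' ->
  hasse_summable y (r - 1) (fun k => INR (S k) * c k) (fun k => c k + INR (S k) * c' k).
Proof.
  intros Hs. assert (L0 := fun x => hasse_term_lim_0 y r c c' x Hs). destruct Hs as [H1 H2].
  assert (ES : forall n x, D y (S n) (fun k => INR (S k) * c k) x
      = INR (S x) * D y (S n) c x - INR (S n) * y * D y n c (S x)).
  { intros n x. rewrite (S_INR x), RtoC_plus, <- D_weight. apply D_ext.
    intros j. now rewrite S_INR, RtoC_plus. }
  split.
  - intros m. destruct (H1 m) as [K [HK HB]]. destruct (H1 (S m)) as [K' [HK' HB']].
    assert (Hy := Cmod_ge_0 y). assert (H2m : (0 <= 2 ^ m)%R) by (apply pow_le; lra).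
    exists (K + Cmod y * 2 ^ m * (K' * exp (Rabs r)))%R. split.
    { apply Rplus_le_le_0_compat; auto. repeat apply Rmult_le_pos; auto. left; apply exp_pos. }
    intros x N Hm.
    assert (HX := INR_S_pos x).
    assert (ER : (Rpower (INR (S x)) (- (r - 1)) = INR (S x) * Rpower (INR (S x)) (- r))%R).
    { replace (- (r - 1))%R with (1 + - r)%R by ring. rewrite Rpower_plus, Rpower_1; auto. }
    eapply Rle_trans; [apply (rsum_shift_le _
       (fun n => INR (S x) * (weight m n * Cmod (D y n c x)))%R
       (fun n => Cmod y * 2 ^ m * (weight (S m) n * Cmod (D y n c (S x))))%R)|].
    + cbn [D]. rewrite Cmod_mult, Cmod_R, Rabs_pos_eq by lra. right; ring.
    + intros n. rewrite ES.
      assert (W := weight_pos m (S n)). assert (W' := weight_succ m n).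
      assert (T := Cmod_triangle (INR (S x) * D y (S n) c x) (- (INR (S n) * y * D y n c (S x)))).
      rewrite Cmod_opp, !Cmod_mult, !Cmod_R, !Rabs_pos_eq in T by apply pos_INR.
      fold (Cminus (INR (S x) * D y (S n) c x) (INR (S n) * y * D y n c (S x))) in T.
      apply Rmult_le_compat_l with (r := weight m (S n)) in T; [|lra].
      eapply Rle_trans; [exact T|].
      assert (Q := Rmult_le_pos _ _ Hy (Cmod_ge_0 (D y n c (S x)))).
      apply Rmult_le_compat_r with (r := (Cmod y * Cmod (D y n c (S x)))%R) in W'; auto.
      lra.
    + intros n. assert (W := weight_pos (S m) n).
      apply Rmult_le_pos; [now apply Rmult_le_pos|].
      apply Rmult_le_pos; [lra | apply Cmod_ge_0].
    + rewrite !rsum_scal, ER.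
      specialize (HB x N Hm). specialize (HB' (S x) N ltac:(lia)).
      assert (HP := Rpower_shift_le r x).
      assert (P : (0 < Rpower (INR (S x)) (- r))%R) by apply exp_pos.
      assert (HX1 : (1 <= INR (S x))%R) by (rewrite S_INR; assert (Z := pos_INR x); lra).
      assert (A : (sum_n (fun n => weight (S m) n * Cmod (D y n c (S x))) N
                  <= K' * exp (Rabs r) * (INR (S x) * Rpower (INR (S x)) (- r)))%R).
      { eapply Rle_trans; [exact HB'|]. rewrite Rmult_assoc. apply Rmult_le_compat_l; auto.
        eapply Rle_trans; [exact HP|]. apply Rmult_le_compat_l; [left; apply exp_pos|]. nra. }
      apply Rmult_le_compat_l with (r := (Cmod y * 2 ^ m)%R) in A; [|now apply Rmult_le_pos].
      apply Rmult_le_compat_l with (r := INR (S x)) in HB; [|lra].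
      lra.
  - intros x.
    replace (- Clog y * (INR (S x) * c x) - (c x + INR (S x) * c' x))
      with (INR (S x) * (- Clog y * c x - c' x) - (c x - 0)) by ring.
    apply Clim_ext with (fun M => INR (S x) * csum (fun n => / INR (S n) * D y (S n) c x) M
       - (c x - D y (S M) c x)).
    + intros M. induction M.
      * rewrite !csum_0, ES. cbn [D]. simpl (INR 1). field.
      * rewrite (csum_S (fun n => / INR (S n) * D y (S n) (fun k => INR (S k) * c k) x)).
        rewrite <- IHM, csum_S, ES. cbn [D]. field. apply RtoC_INR_S_neq.
    + apply Clim_minus; [now apply Clim_scal|].
      apply Clim_minus; [apply Clim_const|]. exact (Clim_incr _ _ (L0 x)).
Qed.

(** * Complex powers of the positive integers *)

Lemma Cmod_Cexp w : Cmod (Cexp w) = exp (Re w).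
Proof.
  unfold Cexp, Cmod. cbn [fst snd].
  replace ((exp (Re w) * cos (Im w)) ^ 2 + (exp (Re w) * sin (Im w)) ^ 2)%R
    with (exp (Re w) * exp (Re w) * ((sin (Im w))² + (cos (Im w))²))%R by (unfold Rsqr; ring).
  rewrite sin2_cos2, Rmult_1_r. apply sqrt_square. left; apply exp_pos.
Qed.

Lemma Cmod_Rcpower X w : Cmod (Rcpower X w) = Rpower X (Re w).
Proof. unfold Rcpower, Rpower. rewrite Cmod_Cexp. f_equal. apply re_scal_r. Qed.

Lemma Rcpower_plus X v w : Rcpower X (v + w) = Rcpower X v * Rcpower X w.
Proof.
  unfold Rcpower, Cexp, Cmult; simpl. rewrite !Rmult_0_r, !Rminus_0_r, !Rplus_0_l.
  rewrite !Rmult_plus_distr_r, exp_plus, cos_plus, sin_plus. f_equal; ring.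
Qed.

Lemma Rcpower_R X (a : R) : Rcpower X a = RtoC (Rpower X a).
Proof.
  unfold Rcpower, Cexp, Rpower, RtoC; simpl.
  rewrite !Rmult_0_r, !Rmult_0_l, Rminus_0_r, Rplus_0_l, cos_0, sin_0. f_equal; ring.
Qed.

Lemma Rcpower_1 X : (0 < X)%R -> Rcpower X 1 = RtoC X.
Proof. intros H. rewrite Rcpower_R. now rewrite Rpower_1. Qed.

Lemma Rcpower_0 X : Rcpower X 0 = 1.
Proof.
  rewrite Rcpower_R. unfold Rpower. now rewrite Rmult_0_l, exp_0.
Qed.

Lemma Rcpower_opp X w : Rcpower X (- w) = / Rcpower X w.
Proof.
  assert (E : Rcpower X w * Rcpower X (- w) = 1).
  { rewrite <- Rcpower_plus, Cplus_opp_r. apply Rcpower_0. }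
  assert (N : Rcpower X w <> 0).
  { intros Z. rewrite Z, Cmult_0_l in E. apply RtoC_inj in E. lra. }
  rewrite <- (Cmult_1_l (/ Rcpower X w)), <- E. field. exact N.
Qed.

Lemma Rcpower_cderiv w x : (0 < x)%R ->
  cderiv (fun t => Rcpower t w) x (w * Rcpower x (w - 1)).
Proof.
  intros Hx.
  assert (E : Rcpower x (w - 1) = Rcpower x w * (/ x)%R).
  { unfold Cminus. rewrite Rcpower_plus, Rcpower_opp, Rcpower_1, RtoC_inv by lra. reflexivity. }
  rewrite E. destruct w as [a b]. unfold Rcpower, Cexp.
  split; simpl; (auto_derive; [auto|]);
    rewrite !Rmult_0_r, ?Ropp_0, ?Rminus_0_r, ?Rplus_0_l, ?Rplus_0_r; ring.
Qed.

(** The rising factorial s (s + 1) ... (s + m - 1). *)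
Fixpoint poch (s : C) (m : nat) : C :=
  match m with O => 1 | S m => poch s m * (s + INR m) end.

Fixpoint rpoch (r : R) (m : nat) : R :=
  match m with O => 1%R | S m => (rpoch r m * (r + INR m))%R end.

Lemma rpoch_pos r m : (0 < r)%R -> (0 < rpoch r m)%R.
Proof.
  intros Hr; induction m; simpl; [lra|]. assert (H := pos_INR m).
  apply Rmult_lt_0_compat; lra.
Qed.

(** Each factor |s + m| exceeds Re s + m only by a relative error of order
    (Im s)^2 / (m + 2)^2, and the product of these errors converges. This is
    where Re s >= 2 makes the error telescope. The inequality plays the role of
    the non-vanishing of Gamma (s). *)
Lemma Cmod_poch_le s m : (2 <= Re s)%R ->
  (Cmod (poch s m) <= exp (Im s ^ 2 * (1 - / INR (S m))) * rpoch (Re s) m)%R.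
Proof.
  intros Hs. set (r := Re s) in *. set (q := Im s).
  induction m.
  - simpl. rewrite Cmod_1, Rinv_1, Rminus_diag, Rmult_0_r, exp_0. lra.
  - simpl poch. rewrite Cmod_mult. simpl rpoch.
    assert (Hm := pos_INR m).
    assert (A : (Cmod (s + INR m) <= exp (q ^ 2 * (/ INR (S m) - / INR (S (S m)))) * (r + INR m))%R).
    { assert (B : (1 + q ^ 2 * (/ INR (S m) - / INR (S (S m))) <=
                    exp (q ^ 2 * (/ INR (S m) - / INR (S (S m)))))%R) by apply exp_ineq1_le.
      eapply Rle_trans; [|apply Rmult_le_compat_r; [lra|exact B]].
      assert (Hq : (0 <= q ^ 2)%R) by nra.
      replace (/ INR (S m) - / INR (S (S m)))%R with (/ ((INR m + 1) * (INR m + 2)))%R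
        by (rewrite !S_INR; field; lra).
      (* e is 1 / (m + 1) - 1 / (m + 2), at least 1 / (Re s + m)^2. *)
      set (e := (/ ((INR m + 1) * (INR m + 2)))%R).
      assert (He : (0 < e)%R) by (apply Rinv_0_lt_compat; nra).
      assert (He' : (1 <= e * (r + INR m) ^ 2)%R).
      { assert (X : (e * ((INR m + 1) * (INR m + 2)) = 1)%R) by (unfold e; field; lra).
        rewrite <- X at 1. apply Rmult_le_compat_l; [lra|]. nra. }
      unfold Cmod. apply Rsqr_incr_0_var.
      - rewrite Rsqr_sqrt by nra. simpl. fold (Re s) (Im s). fold r q.
        unfold Re, Im in r, q. fold r q. unfold Rsqr.
        assert (Z : (0 <= (q ^ 2 * e) ^ 2 * (r + INR m) ^ 2)%R).
        { apply Rmult_le_pos; apply pow2_ge_0. }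
        assert (Z' := Rmult_le_compat_l _ _ _ Hq He').
        nra.
      - apply Rmult_le_pos; [|lra]. assert (X := Rmult_le_pos _ _ Hq (Rlt_le _ _ He)). lra. }
    replace (q ^ 2 * (1 - / INR (S (S m))))%R
      with (q ^ 2 * (1 - / INR (S m)) + q ^ 2 * (/ INR (S m) - / INR (S (S m))))%R by ring.
    rewrite exp_plus.
    eapply Rle_trans; [apply Rmult_le_compat; [apply Cmod_ge_0 | apply Cmod_ge_0 | exact IHm | exact A]|].
    right; ring.
Qed.

Lemma power_tower s : (2 <= Re s)%R ->
  tower (fun m x => poch s m * Rcpower (x + 1) (- (s + INR m)))
        (fun m x => exp (Im s ^ 2) * rpoch (Re s) m * Rpower (x + 1) (- (Re s + INR m)))%R.
Proof.
  intros Hs m x Hx. split; [|split].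
  - assert (X := Rcpower_cderiv (- (s + INR m)) (x + 1) ltac:(lra)).
    apply (cderiv_ext _ _ _ (poch s m * (1%R * (- (s + INR m) * Rcpower (x + 1) (- (s + INR m) - 1))))
       _ (fun _ => eq_refl)).
    + simpl poch. rewrite S_INR, RtoC_plus.
      replace (- (s + INR m) - 1) with (- (s + (INR m + 1))) by ring. ring.
    + apply cderiv_scal.
      apply (cderiv_ext (fun t => Rcpower (1 + 1 * t) (- (s + INR m)))%R _ x
        (1%R * (- (s + INR m) * Rcpower (x + 1) (- (s + INR m) - 1)))); [|reflexivity|].
      * intros t. f_equal. ring.
      * apply (cderiv_comp_affine (fun t => Rcpower t (- (s + INR m)))).
        replace (1 + 1 * x)%R with (x + 1)%R by ring. exact X.
  - unfold Rpower. auto_derive; [lra|].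
    rewrite S_INR. change (rpoch (Re s) (S m)) with (rpoch (Re s) m * (Re s + INR m))%R.
    replace (- (Re s + (INR m + 1)) * ln (x + 1))%R
      with (- (Re s + INR m) * ln (x + 1) + - ln (x + 1))%R by ring.
    rewrite exp_plus, exp_Ropp, exp_ln by lra.
    replace (Im s * (Im s * 1))%R with (Im s ^ 2)%R by ring. ring.
  - rewrite Cmod_mult, Cmod_Rcpower.
    replace (Re (- (s + INR m))) with (- (Re s + INR m))%R by reflexivity.
    apply Rmult_le_compat_r; [left; apply exp_pos|].
    eapply Rle_trans; [now apply Cmod_poch_le|].
    apply Rmult_le_compat_r; [left; apply rpoch_pos; lra|].
    assert (H : (Im s ^ 2 * (1 - / INR (S m)) <= Im s ^ 2)%R).
    { assert (X := Rinv_0_lt_compat _ (INR_S_pos m)). assert (Y := pow2_ge_0 (Im s)). nra. }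
    destruct H as [H | ->]; [left; now apply exp_increasing | apply Rle_refl].
Qed.

Definition npow (s : C) (k : nat) : C := Rcpower (INR (S k)) (- s).

Lemma npow_pred s k : npow s k = INR (S k) * npow (s + 1) k.
Proof.
  unfold npow. rewrite <- (Rcpower_1 (INR (S k)) (INR_S_pos k)).
  rewrite <- Rcpower_plus. f_equal. ring.
Qed.

Lemma npow_hasse_2 y s : (Cmod (1 - y) < 1)%R -> (2 <= Re s)%R ->
  hasse_summable y (Re s) (npow s) (fun k => - s * npow (s + 1) k).
Proof.
  intros Hy Hs.
  refine (hasse_ext y (Re s) (Re s) _ _ _ _ eq_refl _ _
    (tower_hasse y _ _ (Re s) (exp (Im s ^ 2) * (1 + Re s)) (power_tower s Hs) Hy _ _ _)).
  - intros k. simpl poch. rewrite Cmult_1_l. unfold npow.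
    change (INR 0) with 0%R. now rewrite Cplus_0_r, S_INR.
  - intros k. simpl poch. unfold npow. rewrite (S_INR k).
    change (INR 0) with 0%R. change (INR 1) with 1%R. ring.
  - lra.
  - apply Rmult_le_pos; [left; apply exp_pos | lra].
  - intros x Hx. simpl rpoch. simpl INR.
    assert (P := exp_pos (Im s ^ 2)).
    assert (A : (Rpower (x + 1) (- (Re s + 1)) <= Rpower (x + 1) (- (Re s + 0)))%R).
    { apply Rle_Rpower; lra. }
    rewrite !Rplus_0_r in *. assert (B : (0 < Rpower (x + 1) (- Re s))%R) by apply exp_pos.
    assert (C1 : (0 <= exp (Im s ^ 2) * Re s)%R) by (apply Rmult_le_pos; lra).
    nra.
Qed.

(** Every exponent is reached from one with real part at least 2 by finitely
    many uses of [hasse_shift]. *)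
Lemma npow_hasse y s : (Cmod (1 - y) < 1)%R ->
  hasse_summable y (Re s) (npow s) (fun k => - s * npow (s + 1) k).
Proof.
  intros Hy. destruct (INR_unbounded (2 - Re s)) as [p Hp].
  revert s Hp; induction p; intros s Hp.
  - apply npow_hasse_2; auto. simpl in Hp. lra.
  - assert (H : hasse_summable y (Re (s + 1)) (npow (s + 1)) (fun k => - (s + 1) * npow (s + 1 + 1) k)).
    { apply IHp. rewrite S_INR in Hp.
      change (Re (s + 1)) with (Re s + 1)%R. lra. }
    apply hasse_ext with (4 := hasse_shift _ _ _ _ H).
    + change (Re (s + 1)) with (Re s + 1)%R. ring.
    + intros k. symmetry. apply npow_pred.
    + intros k. rewrite (npow_pred (s + 1) k). ring.
Qed.

(** * Summation over the shifts *)

(** With F x the sum of Hasse's series started at x, the logarithmic series is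
    F x - y F (x + 1); multiplied by y^x it telescopes. *)
Lemma hasse_sum y r c c' : hasse_summable y r c c' ->
  is_lim_seq (fun N => Cmod y ^ N * Rpower (INR (S N)) (- r))%R 0 ->
  exists F, Clim (csum (fun n => / INR (S n) * D y n c 0)) F /\
    Clim (csum (fun k => y ^ k * (- Clog y * c k - c' k))) F.
Proof.
  intros [H1 H2] Hlim.
  destruct (H1 0%nat) as [K [HK HB]].
  set (u := fun x n => / INR (S n) * D y n c x).
  assert (Hu : forall x N, (sum_n (fun n => Cmod (u x n)) N <= K * Rpower (INR (S x)) (- r))%R).
  { intros x N. rewrite (rsum_ext _ (fun n => weight 0 n * Cmod (D y n c x))%R).
    - apply HB; lia.
    - intros n. unfold u. now rewrite Cmod_mult, Cmod_inv_INR, weight_0. }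
  set (F := fun x => CSeries (u x)).
  assert (HF : forall x, Clim (csum (u x)) (F x)).
  { intros x. destruct (Clim_absolute (u x) _ (Hu x)) as [l Hl].
    unfold F. now rewrite (Clim_CSeries _ _ Hl). }
  assert (HFb : forall x, (Cmod (F x) <= K * Rpower (INR (S x)) (- r))%R).
  { intros x. apply Clim_Cmod_le with (1 := HF x). intros n.
    eapply Rle_trans; [apply Cmod_csum | apply Hu]. }
  assert (Hstep : forall x, F x - y * F (S x) = - Clog y * c x - c' x).
  { intros x. apply Clim_unique with (2 := H2 x).
    apply Clim_ext with (fun n => csum (u x) n - y * csum (u (S x)) n).
    - intros n. rewrite <- csum_scal.
      replace (csum (u x) n) with (csum (fun k => / INR (S k) * D y (S k) c x) n
        + csum (fun k => y * u (S x) k) n); [ring|].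
      rewrite <- csum_plus. apply csum_ext. intros k _. unfold u. cbn [D]. ring.
    - apply Clim_minus; [|apply Clim_scal]; apply HF. }
  exists (F 0%nat). split; [apply HF|].
  apply Clim_ext with (fun N => F 0%nat - y ^ S N * F (S N)).
  - intros N. induction N.
    + rewrite csum_0, <- Hstep. simpl. ring.
    + rewrite csum_S, <- IHN, <- Hstep. simpl. ring.
  - replace (F 0%nat) with (F 0%nat - 0) at 1 by ring.
    apply Clim_minus; [apply Clim_const|].
    apply (Clim_incr (fun N => y ^ N * F N)). apply Clim_0_Cmod.
    apply is_lim_seq_0_le with (fun N => K * (Cmod y ^ N * Rpower (INR (S N)) (- r)))%R.
    + intros N. rewrite Rabs_pos_eq by apply Cmod_ge_0. rewrite Cmod_mult, Cmod_pow.
      assert (P := pow_le _ N (Cmod_ge_0 y)).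
      assert (X := Rmult_le_compat_l _ _ _ P (HFb N)). lra.
    + replace (Finite 0) with (Finite (K * 0)) by (f_equal; ring).
      apply is_lim_seq_mult'; [apply is_lim_seq_const | exact Hlim].
Qed.

(** * Polylogarithms *)

Lemma C_binomial_S n k : (k < n)%nat ->
  RtoC (Binomial.C (S n) (S k)) = Binomial.C n k + Binomial.C n (S k).
Proof. intros H. now rewrite <- pascal, RtoC_plus by assumption. Qed.

Lemma csum_head u n : csum u (S n) = u O + csum (fun k => u (S k)) n.
Proof. induction n; [now rewrite csum_S, !csum_0 | rewrite csum_S, IHn, csum_S; ring]. Qed.

Lemma D_binomial y n : forall a x,
  D y n a x = csum (fun k => Binomial.C n k * ((- y) ^ k * a (x + k)%nat)) n.
Proof.
  induction n; intros a x.
  - rewrite csum_0, C_n_0. simpl. rewrite Nat.add_0_r. ring.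
  - cbn [D]. rewrite !IHn.
    destruct n as [|n].
    + rewrite csum_S, !csum_0, !C_n_0, C_n_n. simpl. rewrite !Nat.add_0_r, Nat.add_1_r. ring.
    + rewrite (csum_head _ (S n)), (csum_head _ n), C_n_0, C_n_0.
      rewrite (csum_S (fun k => Binomial.C (S (S n)) (S k) * _)), C_n_n.
      rewrite (csum_S (fun k => Binomial.C (S n) k * _)), C_n_n.
      rewrite (csum_ext (fun k => Binomial.C (S (S n)) (S k) * ((- y) ^ S k * a (x + S k)%nat))
        (fun k => Binomial.C (S n) (S k) * ((- y) ^ S k * a (x + S k)%nat)
              + - y * (Binomial.C (S n) k * ((- y) ^ k * a (S x + k)%nat))) n).
      * rewrite csum_plus, csum_scal.
        replace (x + S (S n))%nat with (S x + S n)%nat by lia. simpl. ring.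
      * intros k Hk. rewrite C_binomial_S by lia. rewrite <- plus_n_Sm. simpl. ring.
Qed.

Lemma npow_eq s k : / Rcpower (INR (S k)) s = npow s k.
Proof. symmetry. apply Rcpower_opp. Qed.

Lemma hasse_term s y (e : nat -> C) n :
  (forall k, e k = (- y) ^ k) ->
  1 / INR (n + 1) * sum_n (fun k => Binomial.C n k * (e k / Rcpower (INR (k + 1)) s)) n
  = / INR (S n) * D y n (npow s) 0.
Proof.
  intros He. rewrite D_binomial, Nat.add_1_r.
  replace (sum_n _ n) with (csum (fun k => Binomial.C n k * ((- y) ^ k * npow s (0 + k)%nat)) n).
  - unfold Cdiv. ring.
  - apply csum_ext. intros k _. rewrite Nat.add_1_r, He. unfold Cdiv. now rewrite npow_eq.
Qed.

Lemma polylog_term_npow s y n : polylog_term s y n = y ^ S n * npow s n.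
Proof. unfold polylog_term, Cdiv. now rewrite npow_eq. Qed.

Lemma Cmod_npow s n : Cmod (npow s n) = Rpower (INR (S n)) (- Re s).
Proof. apply Cmod_Rcpower. Qed.

Lemma Rpower_lim_0 a : (0 < a)%R -> is_lim_seq (fun N => Rpower (INR (S N)) (- a)) 0.
Proof.
  intros Ha. apply is_lim_seq_spec. intros eps.
  destruct (INR_unbounded (exp (- ln eps / a))) as [N HN].
  exists N. intros n Hn. rewrite Rminus_0_r, Rabs_pos_eq by (left; apply exp_pos).
  assert (A : (- ln eps / a < ln (INR (S n)))%R).
  { rewrite <- (ln_exp (- ln eps / a)). apply ln_increasing; [apply exp_pos|].
    apply Rlt_le_trans with (1 := HN). apply le_INR; lia. }
  apply Rmult_lt_compat_l with (1 := Ha) in A.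
  replace (a * (- ln eps / a))%R with (- ln eps)%R in A by (field; lra).
  unfold Rpower. rewrite <- (exp_ln eps) by apply cond_pos. apply exp_increasing. lra.
Qed.

Lemma Clog_1 : Clog 1 = 0.
Proof.
  rewrite Clog_right by (simpl; lra). rewrite re_RtoC, im_RtoC.
  unfold Rdiv. rewrite (Rmult_0_l (/ 1)), atan_0.
  replace (1 ^ 2 + 0 ^ 2)%R with 1%R by ring. now rewrite ln_1, Rmult_0_l.
Qed.

Theorem theorem4p6 :
  (forall s y : C,
     s <> 1 ->
     (Cmod (1 - y) < 1)%R ->
     ex_Cseries (polylog_term (s - 1) y) ->
     ex_Cseries (polylog_term s y) ->
     let t := fun n : nat =>
       1 / INR (n + 1) *
       sum_n (fun k : nat =>
                Binomial.C n k * ((-1) ^ k * y ^ k / Rcpower (INR (k + 1)) (s - 1))) n in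
     ex_Cseries t /\
     y / (s - 1) * CSeries t
       = - (Clog y / (s - 1)) * polylog (s - 1) y + polylog s y)
  /\
  (forall s : C,
     (1 < Re s)%R ->
     let t := fun n : nat =>
       1 / INR (n + 1) *
       sum_n (fun k : nat =>
                Binomial.C n k * ((-1) ^ k / Rcpower (INR (k + 1)) (s - 1))) n in
     ex_Cseries t /\
     1 / (s - 1) * CSeries t = polylog s 1 /\
     polylog s 1 = zeta s).
Proof.
  split.
  - intros s y Hs Hy E1 E2 t.
    assert (Hs1 : s - 1 <> 0) by now apply Cminus_eq_contra.
    assert (Hy0 : y <> 0).
    { intros ->. replace (1 - 0) with (RtoC 1) in Hy by ring. rewrite Cmod_1 in Hy. lra. }
    assert (Hy0' : (0 < Cmod y)%R) by now apply Cmod_gt_0.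
    destruct (ex_Cseries_Clim _ E1) as [l1 L1]. destruct (ex_Cseries_Clim _ E2) as [l2 L2].
    destruct (hasse_sum y _ _ _ (npow_hasse y (s - 1) Hy)) as [F [HF1 HF2]].
    { (* The boundary term is, up to the factor |y|, the modulus of the N-th
         term of the series of Li_(s - 1). *)
      assert (X := proj1 (Clim_0_Cmod _) (Clim_term_0 _ _ L1)).
      apply is_lim_seq_ext with (fun N => / Cmod y * Cmod (polylog_term (s - 1) y N))%R.
      - intros N. rewrite polylog_term_npow, Cmod_mult, Cmod_pow, Cmod_npow. cbn [pow]. field. lra.
      - replace (Finite 0) with (Finite (/ Cmod y * 0)) by (f_equal; ring).
        apply is_lim_seq_mult'; [apply is_lim_seq_const | exact X]. }
    assert (Et : forall n, / INR (S n) * D y n (npow (s - 1)) 0 = t n).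
    { intros n. unfold t. rewrite (hasse_term (s - 1) y); trivial.
      intros k. rewrite <- Cpow_mult_l. f_equal. ring. }
    assert (HFt : Clim (csum t) F).
    { apply Clim_ext with (2 := HF1). intros n. apply csum_ext. intros; apply Et. }
    split; [exact (Clim_ex_Cseries _ _ HFt)|].
    rewrite (Clim_CSeries _ _ HFt). unfold polylog.
    rewrite (Clim_CSeries _ _ L1), (Clim_CSeries _ _ L2).
    assert (EF : y * F = - Clog y * l1 + (s - 1) * l2).
    { apply Clim_unique with (1 := Clim_scal y _ _ HF2).
      apply Clim_ext with (fun n => - Clog y * csum (polylog_term (s - 1) y) n
                                    + (s - 1) * csum (polylog_term s y) n).
      - intros n. rewrite <- !csum_scal, <- csum_plus. apply csum_ext. intros k _.
        rewrite !polylog_term_npow. replace (s - 1 + 1) with s by ring. simpl. ring.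
      - apply Clim_plus; now apply Clim_scal. }
    replace (y / (s - 1) * F) with (y * F / (s - 1)) by (unfold Cdiv; ring).
    rewrite EF. field. exact Hs1.
  - intros s Hs t.
    assert (Hs1 : s - 1 <> 0).
    { apply Cminus_eq_contra. intros ->. simpl in Hs. lra. }
    assert (Hy : (Cmod (1 - 1) < 1)%R).
    { replace (1 - 1) with (RtoC 0) by ring. rewrite Cmod_0. lra. }
    destruct (hasse_sum 1 _ _ _ (npow_hasse 1 (s - 1) Hy)) as [F [HF1 HF2]].
    { apply is_lim_seq_ext with (fun N => Rpower (INR (S N)) (- (Re s - 1))).
      - intros N. now rewrite Cmod_1, pow1, Rmult_1_l.
      - apply Rpower_lim_0. lra. }
    assert (Et : forall n, / INR (S n) * D 1 n (npow (s - 1)) 0 = t n).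
    { intros n. unfold t. rewrite (hasse_term (s - 1) 1); trivial.
      intros k. f_equal. ring. }
    assert (HFt : Clim (csum t) F).
    { apply Clim_ext with (2 := HF1). intros n. apply csum_ext. intros; apply Et. }
    assert (HP : Clim (csum (polylog_term s 1)) (/ (s - 1) * F)).
    { apply Clim_ext with (2 := Clim_scal (/ (s - 1)) _ _ HF2).
      intros n. rewrite <- csum_scal. apply csum_ext. intros k _.
      rewrite polylog_term_npow, Clog_1, !Cpow_1_l.
      replace (s - 1 + 1) with s by ring. field. exact Hs1. }
    split; [exact (Clim_ex_Cseries _ _ HFt)|]. split.
    + rewrite (Clim_CSeries _ _ HFt). unfold polylog. rewrite (Clim_CSeries _ _ HP).
      unfold Cdiv. ring.
    + unfold polylog, zeta. apply CSeries_ext. intros n. unfold polylog_term. now rewrite Cpow_1_l.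
Qed.
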